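(* Let $\mathbf G$ be a compact metric graph without cycles. For each $p>1$, let $u_p$ be a least energy solution of the Kirchhoff--Neumann Lane--Emden problem on $\mathbf G$, and let $x_p^+,x_p^-\in\mathbf G$ be a maximum point and a minimum point of $u_p$, respectively. Then $$\operatorname{dist}(x_p^-,x_p^+)\longrightarrow\max_{x,y\in\mathbf G}\operatorname{dist}(x,y)\qquad\text{as }p\to\infty.$$
   Context: Graphs. $\mathbf G=\mathbf G(\mathbf V,\mathbf E)$ is a graph with vertex set $\mathbf V$ and edge set $\mathbf E$; it is connected, has finitely many edges, contains no loops, and no vertex has degree $2$. It is a compact metric graph: each edge $\mathbf e$ is identified with an interval $[0,l(\mathbf e)]$ with $0<l(\mathbf e)<\infty$. $\operatorname{dist}$ is the shortest-path distance on $\mathbf G$. $\mathbf V_{int}$ is the set of vertices of degree $\ge3$, $\mathbf V_{end}$ the set of vertices of degree $1$, and $\mathbf V=\mathbf V_{int}\sqcup\mathbf V_{end}$. Write $\mathbf e\succ\mathbf v$ if $\mathbf e$ is incident to $\mathbf v$. A cycle is a closed path consisting of distinct edges and vertices, except for its initial and terminal vertex, which coincide. Function spaces. $u^{(\mathbf e)}$ is the restriction of $u$ to $\mathbf e$, $\nabla=\frac{d}{dx}$, $\Delta=\frac{d^2}{dx^2}$ on each edge, $\int_{\mathbf G}=\sum_{\mathbf e}\int_0^{l(\mathbf e)}$. $H^1(\mathbf G)$ is the space of continuous $u$ on $\mathbf G$ with $u^{(\mathbf e)}\in H^1(\mathbf e)$ for all $\mathbf e$, with $\|u\|_{H^1(\mathbf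 G)}^2=\int_{\mathbf G}(|\nabla u|^2+u^2)dx$. Least energy solutions. The Kirchhoff--Neumann Lane--Emden problem is: $u$ continuous on $\mathbf G$; $-\Delta u^{(\mathbf e)}=|u^{(\mathbf e)}|^{p-1}u^{(\mathbf e)}$ on each edge; $\sum_{\mathbf e\succ\mathbf v}\partial u^{(\mathbf e)}(\mathbf v)=0$ for each $\mathbf v\in\mathbf V_{int}$; $\partial u^{(\mathbf e)}(\mathbf v)=0$ for each $\mathbf v\in\mathbf V_{end}$ (with $\mathbf e\succ\mathbf v$). Here $\partial u^{(\mathbf e)}(\mathbf v)$ is the outward derivative at $\mathbf v$ along $\mathbf e$ (direction from $\mathbf v$ into $\mathbf e$). Let $J_p(u)=\frac12\int_{\mathbf G}|\nabla u|^2dx-\frac1{p+1}\int_{\mathbf G}|u|^{p+1}dx$, $\mathcal A_p=\{u\in H^1(\mathbf G)\setminus\{0\}:\int_{\mathbf G}|u|^{p-1}u\,dx=0\}$, $\sigma_p^N=\inf_{u\in\mathcal A_p}\sup_{t>0}J_p(tu)$. A least energy solution is a solution $u_p$ of this problem with $J_p(u_p)=\sigma_p^N$; one exists for each $p>1$. *)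

(* Defs.v *)
From HB Require Import structures.
From mathcomp Require Import all_boot all_order all_algebra.
From mathcomp Require Import all_classical all_reals all_analysis.

Set Implicit Arguments.
Unset Strict Implicit.
Unset Printing Implicit Defensive.

Import Order.TTheory GRing.Theory Num.Theory.
Import numFieldNormedType.Exports.

Local Open Scope classical_set_scope.
Local Open Scope ring_scope.

(* Parallel edges are allowed.  The edge [e] is identified with [0, len e],
   where 0 corresponds to [src e] and [len e] to [tgt e]; the orientation is
   only a choice of parametrization. *)
Record graph_data (R : realType) := GraphData {
  vertex : finType;
  edge : finType;
  src : edge -> vertex;
  tgt : edge -> vertex;
  len : edge -> R
}.

Section Graph.
Context {R : realType} (G : graph_data R).
Implicit Types (e : edge G) (v w : vertex G).

Definition incident e v : bool := (src e == v) || (tgt e == v).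

Definition joins e v w : bool :=
  ((src e == v) && (tgt e == w)) || ((src e == w) && (tgt e == v)).

(* Counts incident edges, which is the degree only in the absence of loops. *)
Definition degree v : nat := #|[set e | incident e v]|.

Definition interior_vertex v : bool := (3 <= degree v)%N.
Definition end_vertex v : bool := degree v == 1%N.

Definition adjacent v w : bool := [exists e, joins e v w].

Record compact_metric_graph : Prop := CompactMetricGraph {
  len_gt0 : forall e, 0 < len e;
  no_loop : forall e, src e != tgt e;
  graph_nonempty : (0 < #|vertex G|)%N;
  graph_connected : forall v w, connect adjacent v w;
  (* In particular there are no vertices of degree 0 or 2. *)
  vertex_int_or_end : forall v, interior_vertex v || end_vertex v
}.

(* [ordS] is the cyclic successor, so the last edge returns to [v ord0].
   A cycle of length 2 consists of two parallel edges. *)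
Definition is_cycle n (v : 'I_n.+1 -> vertex G) (e : 'I_n.+1 -> edge G) : Prop :=
  [/\ injective v, injective e & forall i, joins (e i) (v i) (v (ordS i))].

Definition without_cycles : Prop :=
  forall n (v : 'I_n.+1 -> vertex G) (e : 'I_n.+1 -> edge G), ~ is_cycle v e.

(* A vertex has one representative per incident edge; representatives of the
   same point of the metric graph are related by [same_point] below. *)
Record gpoint := GPoint {
  pedge : edge G;
  pcoord : R;
  pcoordP : 0 <= pcoord <= len pedge
}.

Definition at_vertex e (x : R) v : Prop :=
  (x = 0 /\ src e = v) \/ (x = len e /\ tgt e = v).

Definition same_point e (x : R) e' (x' : R) : Prop :=
  (e = e' /\ x = x') \/ exists v, at_vertex e x v /\ at_vertex e' x' v.

(* A path is a sequence of segments; (e, a, b) runs along [e] from the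
   coordinate [a] to the coordinate [b]. *)
Fixpoint is_path e (x : R) (s : seq (edge G * R * R)) e' (x' : R) : Prop :=
  if s is (f, a, b) :: s' then
    [/\ same_point e x f a, 0 <= a <= len f, 0 <= b <= len f
      & is_path f b s' e' x']
  else same_point e x e' x'.

Definition path_length (s : seq (edge G * R * R)) : R :=
  \sum_(g <- s) `|g.2 - g.1.2|.

Definition dist (x y : gpoint) : R :=
  inf [set path_length s | s in
    [set s | is_path (pedge x) (pcoord x) s (pedge y) (pcoord y)]].

(* A function on the metric graph is the family u of its restrictions u e to
   the edges; the values of u e outside [0, len e] are irrelevant. *)
Definition gcontinuous (u : edge G -> R -> R) : Prop :=
  (forall e, {within `[0, len e], continuous (u e)}) /\
  (forall v e x e' x', at_vertex e x v -> at_vertex e' x' v -> u e x = u e' x').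

Definition gint (f : edge G -> R -> R) : R :=
  \sum_(e : edge G) \int[lebesgue_measure]_(x in `[0, len e]) f e x.

End Graph.

Section Sobolev.
Context {R : realType}.
Implicit Types (l : R) (u g phi : R -> R).

Definition test_function l phi : Prop :=
  (forall n x, derivable (derive1n n phi) x 1) /\
  (exists a b, [/\ 0 < a, b < l & forall x, phi x != 0 -> a <= x <= b]).

Definition square_integrable l u : Prop :=
  measurable_fun `[0, l] u /\
  lebesgue_measure.-integrable `[0, l] (fun x => (u x ^+ 2)%:E).

Definition weak_derivative l u g : Prop :=
  forall phi, test_function l phi ->
    \int[lebesgue_measure]_(x in `[0, l]) (u x * derive1 phi x)
    = - \int[lebesgue_measure]_(x in `[0, l]) (g x * phi x).

Definition H1_interval l u : Prop :=
  square_integrable l u /\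
  exists2 g, square_integrable l g & weak_derivative l u g.

End Sobolev.

Section LaneEmden.
Context {R : realType} (G : graph_data R).
Implicit Types (u : edge G -> R -> R) (e : edge G) (v : vertex G) (p : R).

Definition H1 u : Prop :=
  gcontinuous u /\ forall e, H1_interval (len e) (u e).

(* A continuous function in H^1(0, l) is absolutely continuous: it is
   differentiable almost everywhere, and its pointwise derivative, used here,
   is almost everywhere equal to its weak derivative. *)
Definition J p u : R :=
  2^-1 * gint (fun e x => `|derive1 (u e) x| ^+ 2)
  - (p + 1)^-1 * gint (fun e x => `|u e x| `^ (p + 1)).

Definition A_set p : set (edge G -> R -> R) :=
  [set u | [/\ H1 u,
               exists x : gpoint G, u (pedge x) (pcoord x) != 0
             & gint (fun e x => `|u e x| `^ (p - 1) * u e x) = 0]].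

Definition sigma p : \bar R :=
  ereal_inf [set ereal_sup [set (J p (fun e x => t * u e x))%:E
                           | t in [set t : R | 0 < t]]
            | u in A_set p].

(* Difference quotient at the vertex v in the direction from v into e. *)
Definition outward_quotient u e v (h : R) : R :=
  if src e == v then (u e h - u e 0) / h
  else (u e (len e - h) - u e (len e)) / h.

Definition outward_derivative u e v : R :=
  lim (outward_quotient u e v h @[h --> 0^'+]).

Record lane_emden_solution p u : Prop := LaneEmdenSolution {
  le_continuous : gcontinuous u;
  le_derivable : forall e x, 0 < x < len e ->
    derivable (u e) x 1 /\ derivable (derive1 (u e)) x 1;
  le_equation : forall e x, 0 < x < len e ->
    - derive1n 2 (u e) x = `|u e x| `^ (p - 1) * u e x;
  le_outward : forall e v, incident e v ->
    cvg (outward_quotient u e v h @[h --> 0^'+]);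
  le_kirchhoff : forall v, interior_vertex v ->
    \sum_(e | incident e v) outward_derivative u e v = 0;
  le_neumann : forall v e, end_vertex v -> incident e v ->
    outward_derivative u e v = 0
}.

Definition least_energy_solution p u : Prop :=
  lane_emden_solution p u /\ (J p u)%:E = sigma p.

Definition maximum_point u (x : gpoint G) : Prop :=
  forall y : gpoint G, u (pedge y) (pcoord y) <= u (pedge x) (pcoord x).

Definition minimum_point u (x : gpoint G) : Prop :=
  forall y : gpoint G, u (pedge x) (pcoord x) <= u (pedge y) (pcoord y).

Definition is_max_dist (d : R) : Prop :=
  (exists x y : gpoint G, dist x y = d) /\ (forall x y : gpoint G, dist x y <= d).

End LaneEmden.

(* Main.v *)
Require Import Defs.
From mathcomp Require Import all_boot all_order all_algebra.
From mathcomp Require Import all_classical all_reals all_analysis.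
From mathcomp Require Import measurable_realfun.
From mathcomp Require Import lra ring zify.

Set Implicit Arguments.
Unset Strict Implicit.
Unset Printing Implicit Defensive.

Import Order.TTheory GRing.Theory Num.Theory.
Import numFieldNormedType.Exports.

Local Open Scope classical_set_scope.
Local Open Scope ring_scope.

(** Write [q] for the signed power [x |-> `|x| ^ (p - 1) * x] and [D] for the
    diameter of the graph.  For large [p] the least energy problem is governed
    by the minimisation of the Dirichlet energy among functions with
    [max u = 1] and [min u = - 1].  Values [1] and [- 1] at two points at
    distance [r] cost an energy of at least [4 / r], by Cauchy--Schwarz along
    the path joining them, and [4 / D] is attained by a function that is affine
    along a diameter and constant off it.  So a least energy solution must
    place its extrema at distance nearly [D].

    Geometry.  Removing an edge [f] of a tree leaves two sides, so every point
    has an [f]-coordinate in [[0, len f]]: its own coordinate if it lies on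
    [f], and otherwise the end of [f] facing it.  These coordinates embed the
    tree isometrically into an l1 space ([dist_tree_dist]): every segment of a
    path moves one coordinate only, and a simple path crosses an edge once.
    The same coordinates split an increment of [u] into increments over the
    edges ([increment_decomposition]), which gives the Cauchy--Schwarz
    inequality ([increment_energy_bound]), and they define the competitor on a
    diameter ([tent]).

    Energy from above.  Shift the tent by a constant in [[- 1, 1]] so that
    the mean of [q (u)] vanishes ([exists_balancing_shift]).  It keeps absolute
    value at least [1 - eps] on a length independent of [p], and the
    maximum of the energy along its ray is explicit ([fibre_le]); this bounds
    [sigma] and hence the Dirichlet energy [a] of [u] from above by
    [(4 / D) * X ^ (2 / (p - 1))] with [X] of order [(1 - eps) ^ - p]
    ([sigma_upper_bound]).

    Energy from below.  Integrating the equation against [1] and against [u],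
    with the Kirchhoff and Neumann conditions cancelling the boundary terms,
    gives a vanishing integral of [q (u)] and [a = \int |u| ^ (p + 1)]
    ([solution_energy]).  Let [M] and [m] be the maximum and the minimum.  As
    the integral of [q (u)] vanishes, [a] is that of [(u - m) * q (u)], which
    is at most [(M - m) * M ^ p * |G|], and likewise with [- m] in place of
    [M] ([gint_powR_le]).  With [(M - m) ^ 2 <= a * dist] this forces
    [2 <= D * |G| * s ^ (p - 1)] and [4 * s ^ 2 <= a * dist] for the smaller
    [s] of [M] and [- m] ([amplitude_lower_bound]).  Comparing
    the two bounds on [a] yields [(1 - eps) ^ 3 * D <= dist] for large [p]
    ([dist_lower_bound]).

    All this presupposes [u <> 0], that is [0 < sigma] ([sigma_gt0]): a
    competitor changes sign, so its sup norm is controlled by its energy.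
    Here the competitor is an arbitrary continuous [H1] function while the
    energy is the integral of its pointwise derivative, so one has to know
    that a continuous function with a weak derivative [g] is a primitive of
    [g], obtained by testing with smooth steps ([weak_derivative_increment]),
    and is therefore differentiable almost everywhere with derivative [g]
    ([derive1_ae]). *)

(** * The tree metric in edge coordinates *)

Section Sides.
Context {R : realType} (G : graph_data R).
Implicit Types (e f : edge G) (v w : vertex G).

Definition adjacent_avoiding f v w : bool :=
  [exists e, (e != f) && joins e v w].

(** In an acyclic graph [f] alone connects its ends, so this set and its
    complement are the two parts left by the removal of [f]. *)
Definition side f v : bool := connect (adjacent_avoiding f) (src f) v.

Lemma joinsC e v w : joins e v w = joins e w v.
Proof. by rewrite /joins orbC. Qed.

Lemma adjacent_avoiding_sym f : symmetric (adjacent_avoiding f).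
Proof. by move=> v w; apply: eq_existsb => e; rewrite joinsC. Qed.

Lemma side_src f : side f (src f).
Proof. exact: connect0. Qed.

Lemma side_edge e f v w : e != f -> joins e v w -> side f v = side f w.
Proof.
move=> ef jvw; apply: same_connect_r.
  exact: sym_connect_sym (adjacent_avoiding_sym f).
by apply: connect1; apply/existsP; exists e; rewrite ef.
Qed.

Lemma joins_src_tgt e : joins e (src e) (tgt e).
Proof. by rewrite /joins !eqxx. Qed.

Lemma joins_inj e v w v' w' : joins e v w -> joins e v' w' ->
  (v = v' /\ w = w') \/ (v = w' /\ w = v').
Proof.
by move=> /orP[]/andP[/eqP<- /eqP<-] /orP[]/andP[/eqP<- /eqP<-];
   [left|right|right|left].
Qed.

Lemma adjacent_avoiding_path f v p : path (adjacent_avoiding f) v p ->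
  exists E : nat -> edge G, forall i, (i < size p)%N ->
    E i != f /\ joins (E i) (nth v (v :: p) i) (nth v (v :: p) i.+1).
Proof.
move=> /(pathP v) H.
pose E i := odflt f [pick e | (e != f) && joins e (nth v (v :: p) i) (nth v p i)].
exists E => i /H /existsP[e He]; rewrite /E.
by case: pickP => [e' /andP[]//|/(_ e)]; rewrite He.
Qed.

(** Otherwise a simple path from [src f] to [tgt f] avoiding [f], closed up
    by [f], would be a cycle. *)
Lemma side_tgt f : without_cycles G -> src f != tgt f -> ~~ side f (tgt f).
Proof.
move=> acyc loopf; apply/negP => /connectP[q0 q0path q0last].
case/shortenP: q0path q0last => q qpath quniq _ qlast {q0}.
have [E HE] := adjacent_avoiding_path qpath.
have q0 : (0 < size q)%N.
  by case: q qlast {qpath quniq HE} => //= /esym/eqP; rewrite (negbTE loopf).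
pose n := size q.
pose V i := nth (src f) (src f :: q) i.
have Vinj i j : (i <= n)%N -> (j <= n)%N -> V i = V j -> i = j.
  move=> ilt jlt VV; apply/eqP.
  by rewrite -(nth_uniq (src f) _ _ quniq) ?ltnS//; apply/eqP.
have Vn : V n = tgt f by rewrite qlast /V -[n]/((size (src f :: q)).-1) nth_last.
pose E' i := if (i < n)%N then E i else f.
suff : is_cycle (fun i : 'I_n.+1 => V i) (fun i : 'I_n.+1 => E' i) by exact: acyc.
split.
- by move=> i j VV; apply: val_inj; apply: Vinj VV; rewrite -ltnS.
- have aux (i j : nat) : (i < j <= n)%N -> E' i <> E' j.
    move=> /andP[ij jn]; rewrite /E' (leq_trans ij jn).
    have [Eif Eij] := HE i (leq_trans ij jn).
    case: ltnP => [jlt|nj]; last by move/eqP; rewrite (negbTE Eif).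
    have [_ Ejj] := HE j jlt => EE; move: Ejj; rewrite -EE => Ejj.
    have [[VV _]|[VV _]] := joins_inj Eij Ejj.
      have : i = j by apply: Vinj VV; lia.
      by lia.
    have : i = j.+1 by apply: Vinj VV; lia.
    by lia.
  move=> i j EE; apply/val_inj.
  have := ltn_ord i; have := ltn_ord j; rewrite !ltnS => jn il.
  case: (ltngtP (val i) (val j)) => // ij.
  + by case: (@aux i j) => //; rewrite ij.
  + by case: (@aux j i) => //; rewrite ij.
- move=> i; rewrite /E' /=; case: ltnP => iN.
    rewrite modn_small; last by rewrite !ltnS.
    by have [_] := HE i iN.
  have -> : (i = n :> nat) by apply/eqP; rewrite eqn_leq iN -ltnS ltn_ord.
  by rewrite modnn Vn joinsC; exact: joins_src_tgt.
Qed.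

End Sides.

Section TreeMetric.
Context {R : realType} (G : graph_data R).
Context (hG : compact_metric_graph G).
Context (acyc : without_cycles G).
Implicit Types (e f : edge G) (v w : vertex G) (x : R).

(** The end of [f], seen as a coordinate on [f], that faces [v]. *)
Definition vcoord f v : R := if side f v then 0 else len f.

(** The nearest-point projection of the point [(e, x)] to the edge [f].  Any
    vertex of [e] decides on which side of [f] the point lies; [src e] is an
    arbitrary choice. *)
Definition edge_coord f e x : R := if e == f then x else vcoord f (src e).

Definition tree_dist e x e' x' : R := \sum_f `|edge_coord f e x - edge_coord f e' x'|.

Definition vdist v w : R := \sum_f `|vcoord f v - vcoord f w|.

Lemma vcoord_edge e f v w : e != f -> joins e v w -> vcoord f v = vcoord f w.
Proof. by rewrite /vcoord => ef /(side_edge ef) ->. Qed.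

Lemma vcoord_src e : vcoord e (src e) = 0.
Proof. by rewrite /vcoord side_src. Qed.

Lemma vcoord_tgt e : vcoord e (tgt e) = len e.
Proof. by rewrite /vcoord (negbTE (side_tgt acyc (no_loop hG e))). Qed.

Lemma vcoord_itv f v : 0 <= vcoord f v <= len f.
Proof. by rewrite /vcoord; case: ifP; rewrite lexx (ltW (len_gt0 hG f)). Qed.

Lemma coord_itv f e x : 0 <= x <= len e -> 0 <= edge_coord f e x <= len f.
Proof. by rewrite /edge_coord; case: eqP => [->//|_] _; exact: vcoord_itv. Qed.

(** The projections do not depend on the edge that represents a vertex. *)
Lemma coord_vertex f e x v : at_vertex e x v -> edge_coord f e x = vcoord f v.
Proof.
rewrite /edge_coord => -[[-> <-]|[-> <-]]; case: eqP => [->|/eqP ef].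
- by rewrite vcoord_src.
- by [].
- by rewrite vcoord_tgt.
- exact: vcoord_edge ef (joins_src_tgt e).
Qed.

Lemma coord_same_point f e x e' x' :
  same_point e x e' x' -> edge_coord f e x = edge_coord f e' x'.
Proof.
move=> [[-> ->]//|[v [h h']]].
by rewrite (coord_vertex f h) (coord_vertex f h').
Qed.

Lemma tree_dist_segment e a b : tree_dist e a e b = `|b - a|.
Proof.
rewrite /tree_dist (bigD1 e)//= {1 2}/edge_coord eqxx distrC big1 ?addr0// => f fe.
by rewrite /edge_coord eq_sym (negbTE fe) subrr normr0.
Qed.

Lemma tree_dist_triangle e x e' x' e'' x'' :
  tree_dist e x e'' x'' <= tree_dist e x e' x' + tree_dist e' x' e'' x''.
Proof. by rewrite /tree_dist -big_split/=; apply: ler_sum => f _; exact: ler_distD. Qed.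

Lemma tree_dist_path e x s e' x' :
  is_path e x s e' x' -> tree_dist e x e' x' <= path_length s.
Proof.
elim: s e x => [|[[f a] b] s IH] e x /=.
  move=> h; rewrite /path_length big_nil /tree_dist big1// => f _.
  by rewrite (coord_same_point f h) subrr normr0.
move=> [h _ _ /IH]; rewrite /path_length big_cons /= -/(path_length s) => H.
apply: le_trans (tree_dist_triangle _ _ f b _ _) _; apply: lerD => //.
rewrite -(tree_dist_segment f a b) /tree_dist; apply: ler_sum => g _.
by rewrite (coord_same_point g h).
Qed.

Definition end_coord e v : R := if src e == v then 0 else len e.

Lemma at_end_coord e v : incident e v -> at_vertex e (end_coord e v) v.
Proof.
rewrite /incident /end_coord; case: eqP => [|_ /=]; first by left.
by move=> /eqP; right.
Qed.

Lemma end_coord_itv e v : 0 <= end_coord e v <= len e.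
Proof. by rewrite /end_coord; case: ifP; rewrite lexx (ltW (len_gt0 hG e)). Qed.

Lemma joins_incident e v w : joins e v w -> incident e v /\ incident e w.
Proof.
by rewrite /incident => /orP[]/andP[/eqP-> /eqP->]; rewrite !eqxx ?orbT.
Qed.

Lemma vdist_joins e v w : joins e v w -> vdist v w = len e.
Proof.
move=> jvw; rewrite /vdist (bigD1 e)//= big1 => [|f fe]; last first.
  by rewrite (vcoord_edge _ jvw) ?subrr ?normr0// eq_sym.
rewrite addr0; have l0 := ltW (len_gt0 hG e).
move: jvw => /orP[]/andP[/eqP<- /eqP<-]; rewrite vcoord_src vcoord_tgt.
  by rewrite sub0r normrN ger0_norm.
by rewrite subr0 ger0_norm.
Qed.

Lemma end_coord_joins e v w : joins e v w ->
  `|end_coord e w - end_coord e v| = len e.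
Proof.
have l0 := ltW (len_gt0 hG e); have := no_loop hG e.
rewrite /end_coord => h /orP[]/andP[/eqP<- /eqP<-]; rewrite !eqxx (negbTE h).
  by rewrite subr0 ger0_norm.
by rewrite sub0r normrN ger0_norm.
Qed.

(** Each edge of a simple path separates its ends, so the path realises
    [vdist].  [q] is the path in the graph of vertices, [s] its lift. *)
Lemma simple_path_length v q : path (@Defs.adjacent R G) v q -> uniq (v :: q) ->
  forall e x e' x', at_vertex e x v -> at_vertex e' x' (last v q) ->
  exists2 s, is_path e x s e' x' & path_length s = vdist v (last v q).
Proof.
elim: q v => [|w q IH] v /=.
  move=> _ _ e x e' x' h h'; exists [::].
    by right; exists v.
  by rewrite /path_length big_nil /vdist big1// => f _; rewrite subrr normr0.
move=> /andP[/existsP[g gvw] wq] /andP[vq quniq] e x e' x' h h'.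
have [gv gw] := joins_incident gvw.
have [s sp sl] := IH w wq quniq g (end_coord g w) e' x' (at_end_coord gw) h'.
exists ((g, end_coord g v, end_coord g w) :: s) => /=.
  split; rewrite ?end_coord_itv//.
  by right; exists v; split => //; exact: at_end_coord.
rewrite /path_length big_cons /= -/(path_length s) sl (end_coord_joins gvw).
rewrite -(vdist_joins gvw) /vdist -big_split/=; apply: eq_bigr => f _.
have [fg|/eqP fg] := eqVneq g f; last first.
  rewrite (vcoord_edge _ gvw) ?subrr ?normr0 ?add0r//.
  by apply/eqP.
suff -> : vcoord f w = vcoord f (last w q) by rewrite subrr normr0 addr0.
rewrite /vcoord /side; congr (if _ then _ else _).
apply: same_connect_r.
  exact: sym_connect_sym (adjacent_avoiding_sym f).
apply/connectP; exists q => //.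
have {}vq : all (predC1 v) (w :: q).
  by apply/allP => z zq /=; apply: contraNneq vq => <-.
apply: sub_in_path vq wq => a b; rewrite !inE => av bv /existsP[c jc].
apply/existsP; exists c; rewrite jc andbT.
apply: contraNneq av => cf; move: jc; rewrite cf -fg => jc.
have [[-> _]//|[vb _]] := joins_inj gvw jc.
by rewrite vb eqxx in bv.
Qed.

Lemma vertex_path v w e x e' x' : at_vertex e x v -> at_vertex e' x' w ->
  exists2 s, is_path e x s e' x' & path_length s = vdist v w.
Proof.
move=> h h'.
have /connectP[q0 q0path q0last] := graph_connected hG v w.
case/shortenP: q0path q0last => q qpath quniq _ qlast {q0}.
by rewrite qlast; apply: simple_path_length => //; rewrite -qlast.
Qed.

Lemma is_path_rcons e x s f a b : is_path e x s f a ->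
  0 <= a <= len f -> 0 <= b <= len f -> is_path e x (rcons s (f, a, b)) f b.
Proof.
move=> + ha hb; elim: s e x => [|[[g c] d] s IH] e x /=.
  by move=> ?; split => //; left.
by move=> [? ? ? /IH].
Qed.

Lemma coord_incident f e x v : f != e -> incident e v ->
  edge_coord f e x = vcoord f v.
Proof.
move=> fe /at_end_coord /(coord_vertex f) <-.
by rewrite /edge_coord eq_sym (negbTE fe).
Qed.

(** The way from an edge to another one leaves through this vertex. *)
Lemma facing_vertex e e' : exists2 v, incident e v &
  vcoord e v = vcoord e (src e').
Proof.
rewrite {2}/vcoord; case: ifP => _.
  by exists (src e); rewrite /incident ?eqxx// vcoord_src.
by exists (tgt e); rewrite /incident ?eqxx ?orbT// vcoord_tgt.
Qed.

Lemma tree_dist_realized e x e' x' : 0 <= x <= len e -> 0 <= x' <= len e' ->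
  exists2 s, is_path e x s e' x' & path_length s = tree_dist e x e' x'.
Proof.
move=> xe xe'; have [ee'|ee'] := eqVneq e e'.
  subst e'.
  exists [:: (e, x, x')]; first by split => //; left.
  by rewrite tree_dist_segment /path_length big_seq1.
have [v ev vE] := facing_vertex e e'; have [w ew wE] := facing_vertex e' e.
have [s sp sl] := vertex_path (at_end_coord ev) (at_end_coord ew).
exists ((e, x, end_coord e v) :: rcons s (e', end_coord e' w, x')).
  split => //; [by left|exact: end_coord_itv|].
  exact: is_path_rcons sp (end_coord_itv _ _) xe'.
rewrite /path_length big_cons big_rcons /= -/(path_length s) sl.
rewrite -(tree_dist_segment e) -(tree_dist_segment e') -!big_split/=; apply: eq_bigr => f _.
rewrite !(coord_vertex f (at_end_coord _))//.
have off g h z : g != h -> edge_coord g h z = vcoord g (src h).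
  by move=> gh; rewrite /edge_coord eq_sym (negbTE gh).
have [fe|fe] := eqVneq f e.
  rewrite -fe in ee' ev vE *.
  have -> : vcoord f w = vcoord f (src e').
    by rewrite -(coord_incident 0 ee' ew) off.
  by rewrite (off _ _ x' ee') vE !subrr !normr0 !addr0.
rewrite (coord_incident _ fe ev) !subrr normr0 add0r.
have [fe'|fe'] := eqVneq f e'; last first.
  by rewrite (coord_incident _ fe' ew) !subrr normr0 addr0.
rewrite -fe' in ee' ew wE *; rewrite wE.
by rewrite -(coord_incident 0 fe ev) off// subrr normr0 add0r.
Qed.

Theorem dist_tree_dist (y z : gpoint G) :
  dist y z = tree_dist (pedge y) (pcoord y) (pedge z) (pcoord z).
Proof.
have [s sp sl] := tree_dist_realized (pcoordP y) (pcoordP z).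
rewrite /dist; set S := [set _ | _ in _].
have lbS : lbound S (tree_dist (pedge y) (pcoord y) (pedge z) (pcoord z)).
  by move=> _ [t /= tp <-]; exact: tree_dist_path.
have Ss : S (tree_dist (pedge y) (pcoord y) (pedge z) (pcoord z)).
  by exists s.
apply/eqP; rewrite eq_le; apply/andP; split.
  by apply: ge_inf => //; exists (tree_dist (pedge y) (pcoord y) (pedge z) (pcoord z)).
by apply: lb_le_inf => //; exists (tree_dist (pedge y) (pcoord y) (pedge z) (pcoord z)).
Qed.

Lemma tree_distC e x e' x' : tree_dist e x e' x' = tree_dist e' x' e x.
Proof. by apply: eq_bigr => f _; rewrite distrC. Qed.

Lemma tree_dist_vertex e x e' x' v w : at_vertex e x v -> at_vertex e' x' w ->
  tree_dist e x e' x' = vdist v w.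
Proof.
by move=> h h'; apply: eq_bigr => f _; rewrite (coord_vertex f h) (coord_vertex f h').
Qed.

(** Along an edge the distance to a fixed point is convex. *)
Lemma tree_dist_endpoint e x e' x' : 0 <= x <= len e -> 0 <= x' <= len e' ->
  exists v, tree_dist e x e' x' <= tree_dist e (end_coord e v) e' x'.
Proof.
move=> xe xe'.
have split_e z : tree_dist e z e' x' = `|z - edge_coord e e' x'| +
    \sum_(f | f != e) `|vcoord f (src e) - edge_coord f e' x'|.
  rewrite /tree_dist (bigD1 e)//= {1}/edge_coord eqxx; congr (_ + _).
  by apply: eq_bigr => f fe; rewrite /edge_coord eq_sym (negbTE fe).
have := coord_itv e xe'; move: (edge_coord e e' x') split_e => c split_e hc.
have [xc|xc] := leP x c.
  exists (src e); rewrite !split_e lerD2r /end_coord eqxx.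
  by rewrite !ler0_norm; lra.
exists (tgt e); rewrite !split_e lerD2r /end_coord (negbTE (no_loop hG e)).
by rewrite !ger0_norm; lra.
Qed.

Lemma exists_incident v : exists e, incident e v.
Proof.
have : (0 < degree v)%N.
  have /orP[] := vertex_int_or_end hG v; rewrite /interior_vertex /end_vertex.
    by move=> h; apply: leq_trans h.
  by move/eqP ->.
by move=> /card_gt0P[e]; rewrite inE => ?; exists e.
Qed.

(** By convexity the diameter is attained between vertices, of which there are
    finitely many. *)
Lemma exists_diameter : exists v w, [/\ 0 < vdist v w,
  (forall e x e' x', 0 <= x <= len e -> 0 <= x' <= len e' ->
    tree_dist e x e' x' <= vdist v w) & is_max_dist G (vdist v w)].
Proof.
have /card_gt0P[v0 _] := graph_nonempty hG.
have [[v w] _ /= vwmax] := @Order.TotalTheory.arg_maxP _ _ _ (v0, v0) xpredT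
   (fun a : vertex G * vertex G => vdist a.1 a.2) isT.
have bnd e x e' x' : 0 <= x <= len e -> 0 <= x' <= len e' ->
    tree_dist e x e' x' <= vdist v w.
  move=> xe xe'; have [a ha] := tree_dist_endpoint xe xe'.
  have [b hb] := tree_dist_endpoint xe' (end_coord_itv e a).
  apply: le_trans ha _; rewrite tree_distC; apply: le_trans hb _.
  have incident_end f c : exists c', at_vertex f (end_coord f c) c'.
    rewrite /end_coord; case: eqP => [_|_]; first by exists (src f); left.
    by exists (tgt f); right.
  have [a' ha'] := incident_end e a; have [b' hb'] := incident_end e' b.
  by rewrite (tree_dist_vertex hb' ha'); exact: (vwmax (b', a')).
have [e ev] := exists_incident v; have [f fw] := exists_incident w.
exists v, w; split => //.
  have l0 := ltW (len_gt0 hG e).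
  have := bnd e 0 e (len e); rewrite tree_dist_segment subr0 !lexx l0.
  move=> /(_ isT isT); apply: lt_le_trans; rewrite ger0_norm//.
  exact: len_gt0.
split=> [|y z]; last by rewrite dist_tree_dist; apply: bnd; exact: pcoordP.
exists (GPoint (end_coord_itv e v)), (GPoint (end_coord_itv f w)).
by rewrite dist_tree_dist /= (tree_dist_vertex (at_end_coord ev) (at_end_coord fw)).
Qed.

(** Along an edge [e] only the [e]-th summand of [\sum_f u f (edge_coord f _ _)]
    varies, and it varies like [u].  So the difference between this sum and
    [u] is constant on edges, hence on the connected graph. *)
Lemma increment_decomposition (u : edge G -> R -> R) e x e' x' :
  (forall v e x e' x', at_vertex e x v -> at_vertex e' x' v ->
    u e x = u e' x') ->
  u e x - u e' x' = \sum_f (u f (edge_coord f e x) - u f (edge_coord f e' x')).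
Proof.
move=> uV; rewrite big_split/= sumrN.
pose psi e x := \sum_f u f (edge_coord f e x) - u e x.
have psiE g y : psi g y = \sum_(f | f != g) u f (vcoord f (src g)).
  rewrite /psi (bigD1 g) //= {1}/edge_coord eqxx addrAC subrr add0r.
  by apply: eq_bigr => f fg; rewrite /edge_coord eq_sym (negbTE fg).
have psi_edge g y y' : psi g y = psi g y' by rewrite !psiE.
have psi_vertex g y g' y' v : at_vertex g y v -> at_vertex g' y' v ->
    psi g y = psi g' y'.
  move=> h h'; rewrite /psi (uV _ _ _ _ _ h h'); congr (_ - _).
  by apply: eq_bigr => f _; rewrite (coord_vertex f h) (coord_vertex f h').
suff : psi e x = psi e' x' by rewrite /psi; lra.
suff H q v g y : at_vertex g y v -> path (@Defs.adjacent R G) v q ->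
    src e' = last v q -> psi g y = psi e' x'.
  have /connectP[q wq wl] := graph_connected hG (src e) (src e').
  by rewrite (psi_edge e x 0); apply: (H q (src e)) => //; left.
elim: q v g y => [|w q IH] v g y /= gv.
  move=> _ wv; rewrite (psi_edge e' x' 0); apply: (psi_vertex _ _ _ _ v) gv _.
  by left.
move=> /andP[/existsP[h hvw] wq] wl.
have [hv hw] := joins_incident hvw.
rewrite (psi_vertex _ _ _ _ v gv (at_end_coord hv)).
rewrite (psi_edge _ _ (end_coord h w)).
exact: IH (at_end_coord hw) wq wl.
Qed.

(** Cauchy--Schwarz along the path between two points.  Hypothesising the
    inequality [2 l g - l ^ 2 <= g ^ 2] integrated over every subsegment, for
    all slopes [l], avoids any mention of a derivative and is linear in the
    edges: they can be summed with a common [l], which is optimised last. *)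
Lemma increment_energy_bound (u : edge G -> R -> R) (E : edge G -> R) e x e' x' :
  (forall v e x e' x', at_vertex e x v -> at_vertex e' x' v ->
    u e x = u e' x') ->
  (forall f a b l, 0 <= a -> a <= b -> b <= len f ->
     2 * l * (u f b - u f a) - l ^+ 2 * (b - a) <= E f) ->
  0 <= x <= len e -> 0 <= x' <= len e' ->
  (u e x - u e' x') ^+ 2 <= \sum_f E f * tree_dist e x e' x'.
Proof.
move=> uV uE xe xe'.
set L := tree_dist _ _ _ _; set d := u e x - u e' x'.
(* The orientation in which [f] is traversed is absorbed in the sign of [l]. *)
have bound l : 2 * l * d - l ^+ 2 * L <= \sum_f E f.
  rewrite /d (increment_decomposition _ _ _ _ uV) /L /tree_dist !mulr_sumr -sumrB.
  apply: ler_sum => f _.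
  have /andP[a0 al] := coord_itv f xe; have /andP[b0 bl] := coord_itv f xe'.
  have [ab|/ltW ba] := leP (edge_coord f e x) (edge_coord f e' x').
    have := uE f _ _ (- l) a0 ab bl; rewrite sqrrN ler0_norm ?subr_le0//.
    by move=> h; apply: le_trans h; lra.
  by have := uE f _ _ l b0 ba al; rewrite ger0_norm ?subr_ge0.
have L0 : 0 <= L by apply: sumr_ge0.
rewrite -mulr_suml.
have [L_gt0|L_le0] := ltP 0 L.
  have := bound (d / L); rewrite -(ler_pM2r L_gt0); apply: le_trans.
  by rewrite le_eqVlt; apply/orP; left; apply/eqP; field; rewrite gt_eqF.
have L00 : L = 0 by apply/eqP; rewrite eq_le L_le0.
rewrite L00 mulr0.
suff -> : d = 0 by rewrite expr0n.
apply/eqP/negP => /negP d0.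
(* With [L = 0] the bound is linear in [l], so [d] has to vanish. *)
have := bound ((\sum_f E f + 1) / (2 * d)).
rewrite L00 mulr0 subr0 (_ : 2 * _ * d = \sum_f E f + 1).
  by rewrite leNgt ltrDl ltr01.
by field.
Qed.

End TreeMetric.

(** * Smooth functions of compact support *)

Section Smooth.
Context {R : realType}.
Implicit Types (f g : R -> R) (a b x : R).

Lemma is_derive1D f g x a b : is_derive x 1 f a -> is_derive x 1 g b ->
  is_derive x 1 (fun y => f y + g y) (a + b).
Proof. exact: is_deriveD. Qed.

Lemma is_derive1M f g x a b : is_derive x 1 f a -> is_derive x 1 g b ->
  is_derive x 1 (fun y => f y * g y) (f x * b + g x * a).
Proof. exact: is_deriveM. Qed.

Lemma is_derive1Z k f x a : is_derive x 1 f a ->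
  is_derive x 1 (fun y => k * f y) (k * a).
Proof. by move=> df; exact: (is_deriveZ k df). Qed.

Lemma is_derive1_affine a b x : is_derive x 1 (fun y => a * y + b) a.
Proof.
have := is_derive1D (is_derive1M (is_derive_cst a x 1) (is_derive_id x 1))
  (is_derive_cst b x 1).
by rewrite /cst /= mulr0 mulr1 !addr0.
Qed.

(** Phrased with iterated derivatives, as test functions are; the lemmas below
    replace it by an induction on the order. *)
Definition times_derivable n f : Prop :=
  forall k, (k < n)%N -> forall x, derivable (derive1n k f) x 1.

Definition smooth f := forall n, times_derivable n f.

Lemma times_derivable0 f : times_derivable 0 f.
Proof. by []. Qed.

Lemma times_derivableS n f : (forall x, derivable f x 1) ->
  times_derivable n (derive1 f) -> times_derivable n.+1 f.
Proof. by move=> df nf' [_ //|k kn x]; rewrite derive1Sn; exact: nf'. Qed.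

Lemma times_derivable_derive1 n f :
  times_derivable n.+1 f -> times_derivable n (derive1 f).
Proof. by move=> nf k kn x; rewrite -derive1Sn; exact: nf. Qed.

Lemma times_derivableP n f f' : (forall x, is_derive x 1 f (f' x)) ->
  times_derivable n f' -> times_derivable n.+1 f.
Proof.
move=> df nf'; apply: times_derivableS; first by move=> x; have [] := df x.
suff -> : (derive1 f) = f' by [].
by apply/funext => x; rewrite derive1E derive_val.
Qed.

Lemma times_derivable_is_derive n f : times_derivable n.+1 f ->
  forall x, is_derive x 1 f ((derive1 f) x).
Proof. by move=> nf x; apply: DeriveDef; [exact: (nf 0%N)|rewrite derive1E]. Qed.

Lemma times_derivable_le n f : times_derivable n.+1 f -> times_derivable n f.
Proof. by move=> nf k kn; apply: nf; exact: ltnW. Qed.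

Lemma times_derivableD n f g : times_derivable n f -> times_derivable n g ->
  times_derivable n (fun x => f x + g x).
Proof.
elim: n f g => [|n IH] f g nf ng; first exact: times_derivable0.
have df := times_derivable_is_derive nf; have dg := times_derivable_is_derive ng.
apply: (times_derivableP (fun x => is_derive1D (df x) (dg x))).
by apply: IH; exact: times_derivable_derive1.
Qed.

Lemma times_derivableM n f g : times_derivable n f -> times_derivable n g ->
  times_derivable n (fun x => f x * g x).
Proof.
elim: n f g => [|n IH] f g nf ng; first exact: times_derivable0.
have df := times_derivable_is_derive nf; have dg := times_derivable_is_derive ng.
apply: (times_derivableP (fun x => is_derive1M (df x) (dg x))).
apply: times_derivableD; apply: IH.
- exact: times_derivable_le.
- exact: times_derivable_derive1.
- exact: times_derivable_le.
- exact: times_derivable_derive1.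
Qed.

Lemma times_derivable_cst n a : times_derivable n (fun=> a).
Proof.
elim: n a => [|n IH] a; first exact: times_derivable0.
exact: (times_derivableP (fun x => is_derive_cst a x 1)).
Qed.

Lemma times_derivable_affine n f a b : times_derivable n f ->
  times_derivable n (fun x => f (a * x + b)).
Proof.
elim: n f => [|n IH] f nf; first exact: times_derivable0.
 have df := times_derivable_is_derive nf.
have dc x : is_derive x 1 (fun x => f (a * x + b)) (derive1 f (a * x + b) * a).
  exact: (@is_derive1_comp _ f (fun x => a * x + b) _ _ _ (df _) (is_derive1_affine a b x)).
apply: (times_derivableP dc).
apply: times_derivableM; last exact: times_derivable_cst.
by apply: IH; exact: times_derivable_derive1.
Qed.

(** [exp (- 1 / x) / x ^ n], extended by [0].  This family is closed under
    derivation up to linear combinations, which makes smoothness an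
    induction. *)
Definition flat n x : R := if 0 < x then x^-1 ^+ n * expR (- x^-1) else 0.

Lemma flat_ge0 n x : 0 <= flat n x.
Proof.
rewrite /flat; case: ifP => // x0.
by rewrite mulr_ge0 ?expR_ge0// exprn_ge0// invr_ge0 ltW.
Qed.

Lemma flat_gt0 n x : 0 < x -> 0 < flat n x.
Proof. by move=> x0; rewrite /flat x0 mulr_gt0 ?expR_gt0// exprn_gt0// invr_gt0. Qed.

Lemma flatS n x : flat n x = flat n.+1 x * x.
Proof.
rewrite /flat; case: ifP => [x0|_]; last by rewrite mul0r.
by rewrite exprS; field; rewrite gt_eqF.
Qed.

(** The exponential beats every power. *)
Lemma flat_le n x : flat n x <= n.+1`!%:R * `|x|.
Proof.
rewrite /flat; case: ifPn => [x0|_]; last by rewrite mulr_ge0.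
rewrite gtr0_norm// expRN ler_pdivrMr ?expR_gt0//.
have /(expR_ge1Dxn n) h : 0 <= x^-1 by rewrite invr_ge0 ltW.
rewrite -(ler_pM2r (_ : 0 < x^-1)) ?invr_gt0// -exprSr.
have f0 : (0 : R) < n.+1`!%:R by rewrite ltr0n fact_gt0.
have -> : n.+1`!%:R * x * expR x^-1 / x = n.+1`!%:R * expR x^-1.
  by field; rewrite gt_eqF.
rewrite mulrC -ler_pdivrMr//; apply: le_trans h.
by rewrite lerDr.
Qed.

Lemma flat_continuous0 n : {for 0, continuous (flat n)}.
Proof.
rewrite /prop_for /continuous_at {2}/flat ltxx.
apply: (@squeeze_cvgr _ _ _ _ (cst 0) (fun x => n.+1`!%:R * `|x|)).
- by near=> x; rewrite flat_ge0 flat_le.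
- exact: cvg_cst.
- rewrite -[X in _ --> X](mulr0 n.+1`!%:R); apply: cvgMr.
  rewrite -[X in _ --> X](@normr0 _ R); apply: cvg_norm; exact: cvg_id.
Unshelve. all: by end_near. Qed.

Lemma is_derive_flat n x :
  is_derive x 1 (flat n) (- n%:R * flat n.+1 x + flat n.+2 x).
Proof.
have [x0|x0|->] := ltgtP x 0.
- rewrite /flat !ltNge !(ltW x0) /= mulr0 addr0.
  apply: (near_eq_is_derive _ (is_derive_cst (0 : R) x (1 : R))).
  near=> y; have y0 : y < 0 by near: y; exact: lt_nbhsl.
  by rewrite /= ltNge (ltW y0).
- suff H : is_derive x 1 (fun y => y^-1 ^+ n * expR (- y^-1))
      (- n%:R * flat n.+1 x + flat n.+2 x).
    apply: (near_eq_is_derive _ H).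
    near=> y; have y0 : 0 < y by near: y; exact: lt_nbhsr.
    by rewrite /flat y0.
  have xN0 : x != 0 by rewrite gt_eqF.
  have dV : is_derive x 1 (fun y : R => y^-1) (- x ^- 2).
    apply: (is_derive_eq (is_deriveV xN0 (is_derive_id x 1))).
    by rewrite /= -[_ *: _]/(_ * _) mulr1.
  have dE : is_derive x 1 (fun y : R => expR (- y^-1)) (expR (- x^-1) * x ^- 2).
    apply: (@is_derive1_comp _ expR (fun y : R => - y^-1)).
    by apply: (is_derive_eq (is_deriveN dV)); rewrite opprK.
  have dX : is_derive x 1 (fun y : R => y^-1 ^+ n) (- n%:R * x^-1 ^+ n.+1).
    case: n => [|n].
      rewrite oppr0 mul0r; have := @is_derive_cst R R R 1 x 1.
      by congr is_derive; apply/funext => y; rewrite expr0.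
    have -> : (fun y : R => y^-1 ^+ n.+1) = (fun y => y^-1) ^+ n.+1.
      by apply/funext => y; rewrite exprfctE.
    apply: (is_derive_eq (is_deriveX n.+1 dV)).
    rewrite -[_ *: _]/(_ * _) -exprVn !exprS expr0 /=.
    ring.
  apply: (is_derive_eq (is_derive1M dX dE)).
  rewrite /flat x0 -exprVn !exprS expr0.
  ring.
(* At the origin the difference quotient of [flat n] is [flat n.+1]. *)
- rewrite /flat ltxx mulr0 addr0; apply/is_derive1_caratheodory.
  exists (flat n.+1); split; last by rewrite /flat ltxx.
    by move=> z; rewrite /flat ltxx !subr0 -!/(flat _ _) flatS.
  exact: flat_continuous0.
Unshelve. all: by end_near. Qed.

Lemma smooth_flat n : smooth (flat n).
Proof.
move=> k; elim: k n => [|k IH] n; first exact: times_derivable0.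
apply: (times_derivableP (is_derive_flat n)).
by apply: times_derivableD => //; apply: times_derivableM => //;
   exact: times_derivable_cst.
Qed.

Definition mollifier a b x : R := flat 0 (x - a) * flat 0 (b - x).

Lemma smooth_mollifier a b : smooth (mollifier a b).
Proof.
move=> n; apply: times_derivableM.
  have := @times_derivable_affine n (flat 0) 1 (- a) (@smooth_flat 0 n).
  by congr times_derivable; apply/funext => x; rewrite mul1r.
have := @times_derivable_affine n (flat 0) (- 1) b (@smooth_flat 0 n).
by congr times_derivable; apply/funext => x; rewrite mulN1r addrC.
Qed.

Lemma mollifier_ge0 a b x : 0 <= mollifier a b x.
Proof. by rewrite mulr_ge0 ?flat_ge0. Qed.

Lemma mollifier_gt0 a b x : a < x < b -> 0 < mollifier a b x.
Proof. by move=> /andP[ax xb]; rewrite mulr_gt0 ?flat_gt0 ?subr_gt0. Qed.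

Lemma mollifier_eq0 a b x : ~~ (a < x < b) -> mollifier a b x = 0.
Proof.
rewrite negb_and /mollifier /flat !subr_gt0 => /orP[]/negbTE ->.
  by rewrite mul0r.
by rewrite mulr0.
Qed.

Lemma mollifier_continuous a b : continuous (mollifier a b).
Proof.
move=> x; apply/differentiable_continuous/derivable1_diffP.
exact: (@smooth_mollifier a b 1%N 0%N).
Qed.

End Smooth.

(** * Integrals over a segment *)

Section Segment.
Context {R : realType}.
Notation mu := (@lebesgue_measure R).
Implicit Types (f g : R -> R) (a b c x : R).

Lemma integrable_seg f a b : {within `[a, b], continuous f} ->
  mu.-integrable `[a, b] (EFin \o f).
Proof. by apply: continuous_compact_integrable; exact: segment_compact. Qed.

Lemma integrable_sub f a b c d : a <= c -> d <= b ->
  mu.-integrable `[a, b] (EFin \o f) -> mu.-integrable `[c, d] (EFin \o f).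
Proof.
move=> ac db; apply: integrableS => // x /=; rewrite !in_itv/= => /andP[cx xd].
by rewrite (le_trans ac cx) (le_trans xd db).
Qed.

Lemma integral_seg_cat f a b c : a <= c -> c <= b ->
  mu.-integrable `[a, b] (EFin \o f) ->
  \int[mu]_(x in `[a, b]) f x =
  \int[mu]_(x in `[a, c]) f x + \int[mu]_(x in `[c, b]) f x.
Proof.
move=> ac cb fi.
have := @Rintegral_itvB R f (BLeft a) (BRight b) c fi.
rewrite !bnd_simp => /(_ ac cb) /eqP; rewrite subr_eq => /eqP ->.
rewrite addrC Rintegral_itv_obnd_cbnd//.
apply: integrableS fi => // x /=; rewrite !in_itv/= => /andP[cx ->].
by rewrite (le_trans ac (ltW cx)).
Qed.

Lemma integral_seg_le f g a b : mu.-integrable `[a, b] (EFin \o f) ->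
  mu.-integrable `[a, b] (EFin \o g) -> (forall x, a <= x <= b -> f x <= g x) ->
  \int[mu]_(x in `[a, b]) f x <= \int[mu]_(x in `[a, b]) g x.
Proof.
by move=> fi gi fg; apply: le_Rintegral => // x /=; rewrite in_itv/=; exact: fg.
Qed.

Lemma eq_integral_seg f g a b : (forall x, a <= x <= b -> f x = g x) ->
  \int[mu]_(x in `[a, b]) f x = \int[mu]_(x in `[a, b]) g x.
Proof.
by move=> fg; apply: eq_Rintegral => x; rewrite inE/= in_itv/=; exact: fg.
Qed.

Lemma integral_seg_cst a b c : a <= b -> \int[mu]_(x in `[a, b]) c = c * (b - a).
Proof.
move=> ab; rewrite Rintegral_cst//= lebesgue_measure_itv /= lte_fin.
move: ab; rewrite le_eqVlt => /predU1P[->|ab].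
  by rewrite ltxx subrr.
by rewrite ab.
Qed.

Lemma integrable_cst_seg a b c : mu.-integrable `[a, b] (EFin \o (fun=> c)).
Proof. by apply: integrable_seg; exact: cst_continuous. Qed.

End Segment.

(** * Smooth steps *)

Section Step.
Context {R : realType}.
Notation mu := (@lebesgue_measure R).
Context (a b : R).
Implicit Types t x y : R.
Context (ab : a < b).

(** The lower bound of integration is infinite so that the fundamental theorem
    applies at every point. *)
Definition mollifier_primitive t : R := \int[mu]_(x in `]-oo, t]) mollifier a b x.

Lemma integrable_mollifier : mu.-integrable setT (EFin \o mollifier a b).
Proof.
have -> : mollifier a b = mollifier a b \_ `[a, b].
  apply/funext => x; rewrite patchE; case: ifPn => //.
  rewrite notin_setE/= in_itv/= => xab; rewrite mollifier_eq0//.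
  by apply/negP => /andP[/ltW ax /ltW xb]; apply: xab; rewrite ax.
rewrite -restrict_EFin; apply/integrable_restrict => //=; rewrite setTI.
apply: integrable_seg.
by apply: continuous_subspaceT; exact: mollifier_continuous.
Qed.

Lemma is_derive_mollifier_primitive t : is_derive t 1 mollifier_primitive (mollifier a b t).
Proof.
have ib u : mu.-integrable [set` Interval -oo%O (BRight u)] (EFin \o mollifier a b).
  by apply: integrableS integrable_mollifier.
have tt : t < t + 1 by rewrite ltrDl.
have ct : {for t, continuous (mollifier a b)} by exact: mollifier_continuous.
have [] := continuous_FTC1 tt (ib (t + 1)) (ltNyr _) ct.
by move=> d dE; apply: DeriveDef; [exact: d|rewrite -derive1E; exact: dE].
Qed.

Lemma mollifier_primitive_MVT x y : x < y ->
  exists2 c, x < c < y & mollifier_primitive y - mollifier_primitive x = mollifier a b c * (y - x).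
Proof.
move=> xy; have [||c] := @MVT R mollifier_primitive (mollifier a b) _ _ xy.
- by move=> c _; exact: is_derive_mollifier_primitive.
- apply: continuous_subspaceT => c; apply/differentiable_continuous/derivable1_diffP.
  by have [] := is_derive_mollifier_primitive c.
by rewrite in_itv/=; exists c.
Qed.

Lemma mollifier_primitive_left t : t <= a -> mollifier_primitive t = 0.
Proof.
move=> ta; rewrite /mollifier_primitive (@eq_Rintegral _ _ _ _ _ (cst 0)).
  by rewrite /Rintegral integral0.
move=> x; rewrite inE/= in_itv/= => xt; rewrite mollifier_eq0// negb_and -leNgt.
by rewrite (le_trans xt ta).
Qed.

Lemma mollifier_primitive_right t : b <= t -> mollifier_primitive t = mollifier_primitive b.
Proof.
rewrite le_eqVlt => /predU1P[->//|bt].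
have [c /andP[bc _] /eqP] := mollifier_primitive_MVT bt.
rewrite mollifier_eq0 ?mul0r ?subr_eq0 => [/eqP//|].
by rewrite negb_and -!leNgt (ltW bc) orbT.
Qed.

Lemma mollifier_mass_gt0 : 0 < mollifier_primitive b.
Proof.
have [c cab] := mollifier_primitive_MVT ab.
rewrite (mollifier_primitive_left (lexx a)) subr0 => ->.
by rewrite mulr_gt0 ?subr_gt0// mollifier_gt0.
Qed.

(** A smooth transition from [0] before [a] to [1] after [b]. *)
Definition step t : R := (mollifier_primitive b)^-1 * mollifier_primitive t.

Definition step_derivative t : R := (mollifier_primitive b)^-1 * mollifier a b t.

Lemma is_derive_step t : is_derive t 1 step (step_derivative t).
Proof.
exact: is_derive1Z (is_derive_mollifier_primitive t).
Qed.

Lemma smooth_step : smooth step.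
Proof.
move=> n; apply: times_derivable_le; apply: (times_derivableP is_derive_step).
by apply: times_derivableM; [exact: times_derivable_cst|exact: smooth_mollifier].
Qed.

Lemma step_left t : t <= a -> step t = 0.
Proof. by move=> ta; rewrite /step (mollifier_primitive_left ta) mulr0. Qed.

Lemma step_right t : b <= t -> step t = 1.
Proof.
move=> bt; rewrite /step (mollifier_primitive_right bt) mulVf// gt_eqF//.
exact: mollifier_mass_gt0.
Qed.

Lemma step_derivative_ge0 t : 0 <= step_derivative t.
Proof. by rewrite mulr_ge0 ?mollifier_ge0// invr_ge0 ltW// mollifier_mass_gt0. Qed.

Lemma step_derivative_eq0 t : ~~ (a < t < b) -> step_derivative t = 0.
Proof. by move=> tab; rewrite /step_derivative mollifier_eq0// mulr0. Qed.

Lemma step_nondecreasing x y : x <= y -> step x <= step y.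
Proof.
rewrite le_eqVlt => /predU1P[->//|xy].
rewrite ler_pM2l ?invr_gt0 ?mollifier_mass_gt0// -subr_ge0.
have [c _ ->] := mollifier_primitive_MVT xy.
by rewrite mulr_ge0 ?mollifier_ge0// subr_ge0 ltW.
Qed.

Lemma step_itv t : 0 <= step t <= 1.
Proof.
apply/andP; split.
  have [ta|/ltW at_] := leP t a; first by rewrite step_left.
  by rewrite -(step_left (lexx a)) step_nondecreasing.
have [bt|/ltW tb] := leP b t; first by rewrite step_right.
by rewrite -(step_right (lexx b)) step_nondecreasing.
Qed.

Lemma step_continuous : continuous step.
Proof.
move=> t; apply/differentiable_continuous/derivable1_diffP.
by have [] := is_derive_step t.
Qed.

Lemma step_derivative_continuous : continuous step_derivative.
Proof. by move=> t; apply: cvgMr; exact: mollifier_continuous. Qed.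

Lemma integral_step_derivative l : 0 <= a -> b <= l ->
  \int[mu]_(x in `[0, l]) step_derivative x = 1.
Proof.
move=> a0 bl; have l0 : 0 < l by rewrite (le_lt_trans a0)// (lt_le_trans ab).
rewrite /Rintegral (@continuous_FTC2 _ _ step)//=.
- by rewrite step_right// step_left// subr0.
- by apply: continuous_subspaceT; exact: step_derivative_continuous.
- split.
  + by move=> x _; have [] := is_derive_step x.
  + by apply/cvg_at_right_filter; exact: step_continuous.
  + by apply/cvg_at_left_filter; exact: step_continuous.
- by move=> x _; rewrite derive1E; apply: derive_val; exact: is_derive_step.
Qed.

End Step.

(** * Weak derivatives of continuous functions *)

Section WeakDerivative.
Context {R : realType}.
Notation mu := (@lebesgue_measure R).
Implicit Types (u f g : R -> R) (l a b x y eta : R).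

Lemma within_continuousM f g a b : {within `[a, b], continuous f} ->
  {within `[a, b], continuous g} ->
  {within `[a, b], continuous (fun x : R => f x * g x : R)}.
Proof. by move=> cf cg z; apply: continuousM; [exact: cf|exact: cg]. Qed.

Lemma integrable_seg_norm f a b : mu.-integrable `[a, b] (EFin \o f) ->
  mu.-integrable `[a, b] (EFin \o (fun t => `|f t|)).
Proof. by move=> /integrable_norm. Qed.

Let measurable_seg a b : measurable (`[a, b] : set (measurableTypeR R)).
Proof. by []. Qed.

Lemma integrable_segB f g a b : mu.-integrable `[a, b] (EFin \o f) ->
  mu.-integrable `[a, b] (EFin \o g) ->
  mu.-integrable `[a, b] (EFin \o (fun t => f t - g t)).
Proof. by move=> fi gi; have := integrableB (measurable_seg a b) fi gi; apply: eq_integrable => // x _; rewrite /= EFinB. Qed.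

Lemma integrable_segZ f a b c : mu.-integrable `[a, b] (EFin \o f) ->
  mu.-integrable `[a, b] (EFin \o (fun t => c * f t)).
Proof. by move=> fi; have := integrableZl (measurable_seg a b) c fi; apply: eq_integrable => // x _; rewrite /= EFinM. Qed.

(** The derivative of a step is an approximate identity at [x]. *)
Lemma step_average l u x eta : 0 < x < l -> {within `[0, l], continuous u} ->
  0 < eta -> exists2 d, 0 < d & forall e, 0 < e < d -> x + e < l /\
    `|\int[mu]_(t in `[0, l]) (u t * step_derivative x (x + e) t) - u x| <= eta.
Proof.
move=> /andP[x0 xl] cu eta0; have l0 := lt_trans x0 xl.
have cux : {for x, continuous u}.
  by apply: (within_continuous_continuous l0 cu); rewrite in_itv/= x0.
have /cvgrPdist_le /(_ eta eta0) /nbhs_ballP[r /= r0 rP] := cux.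
exists (Num.min r (l - x)); first by rewrite lt_min r0 subr_gt0.
move=> e; rewrite lt_min ltrBrDl => /and3P[e0 er xel]; split => //.
have xe : x < x + e by rewrite ltrDl.
have csd : {within `[0, l], continuous (step_derivative x (x + e))}.
  by apply: continuous_subspaceT; exact: step_derivative_continuous.
have isd := integrable_seg csd.
have iu := integrable_seg (within_continuousM cu csd).
have int_cst c : \int[mu]_(t in `[0, l]) (c * step_derivative x (x + e) t) = c.
  by rewrite RintegralZl// integral_step_derivative ?mulr1// ltW.
have icst c : mu.-integrable `[0, l]
    (EFin \o (fun t => c * step_derivative x (x + e) t)).
  apply: integrable_seg; apply: within_continuousM => //.
  by move=> z; exact: cst_continuous.
have bound t : `|u t - u x| * step_derivative x (x + e) t <=
               eta * step_derivative x (x + e) t.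
  have [/andP[xt txe]|h] := boolP (x < t < x + e); last first.
    by rewrite step_derivative_eq0// !mulr0.
  rewrite ler_wpM2r ?step_derivative_ge0// distrC; apply: rP.
  by rewrite /ball/= distrC ger0_norm ?subr_ge0 1?ltW// ltrBlDl (lt_trans txe)// ltrD2l.
rewrite ler_norml; apply/andP; split.
  rewrite lerBrDl -[leLHS](int_cst (u x - eta)); apply: integral_seg_le => //.
  move=> t _; rewrite -subr_ge0 -mulrBl.
  have := bound t; rewrite -subr_ge0 -mulrBl => /le_trans; apply.
  rewrite ler_wpM2r ?step_derivative_ge0//.
  by have := ler_norm (- (u t - u x)); rewrite normrN; lra.
rewrite lerBlDl -[leRHS](int_cst (u x + eta)); apply: integral_seg_le => //.
move=> t _; rewrite -subr_ge0 -mulrBl.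
have := bound t; rewrite -subr_ge0 -mulrBl => /le_trans; apply.
rewrite ler_wpM2r ?step_derivative_ge0//.
by have := ler_norm (u t - u x); lra.
Qed.

Lemma integrable_mul_step l g a b : a < b ->
  mu.-integrable `[0, l] (EFin \o g) ->
  mu.-integrable `[0, l] (EFin \o (fun t => g t * step a b t)).
Proof.
move=> ab ig; apply: (le_integrable _ _ _ ig) => //.
  apply/measurable_EFinP; apply: measurable_funM.
    by move/integrableP : ig => [/measurable_EFinP].
  apply: measurable_funTS; apply: continuous_measurable_fun.
  exact: step_continuous.
move=> t _ /=; rewrite lee_fin normrM ler_piMr//.
by have /andP[s0 s1] := step_itv ab t; rewrite ger0_norm.
Qed.

(** A narrow step at [x] truncates [g] to the right of [x], up to the integral
    of [|g|] over the transition zone. *)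
Lemma step_truncation l g x eta : 0 < x < l ->
  mu.-integrable `[0, l] (EFin \o g) ->
  0 < eta -> exists2 d, 0 < d & forall e, 0 < e < d -> x + e < l /\
    `|\int[mu]_(t in `[0, l]) (g t * step x (x + e) t) -
      \int[mu]_(t in `[x, l]) g t| <= eta.
Proof.
move=> /andP[x0 xl] ig eta0; have l0 := lt_trans x0 xl.
have ign : mu.-integrable `[x, l] (EFin \o (fun t => `|g t|)).
  by apply: integrable_seg_norm; apply: integrable_sub ig => //; exact: ltW.
have /nbhs_ballP[r /= r0 rP] := parameterized_integral_near_left xl eta0 ign.
exists (Num.min r (l - x)); first by rewrite lt_min r0 subr_gt0.
move=> e; rewrite lt_min ltrBrDl => /and3P[e0 er xel]; split => //.
have xe : x < x + e by rewrite ltrDl.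
have igs := integrable_mul_step xe ig.
have igx := integrable_sub (ltW x0) (lexx l) ig.
have igxe := integrable_sub (lexx x) (ltW xel) igx.
have igsx := integrable_sub (ltW x0) (lexx l) igs.
have igsxe := integrable_sub (lexx x) (ltW xel) igsx.
rewrite (integral_seg_cat (ltW x0) (ltW xl) igs).
rewrite (integral_seg_cat (ltW xe) (ltW xel) igsx).
rewrite (integral_seg_cat (ltW xe) (ltW xel) igx).
rewrite (@eq_integral_seg _ _ (fun=> 0) 0 x) => [|t /andP[_ tx]]; last first.
  by rewrite step_left// mulr0.
rewrite (@eq_integral_seg _ _ g (x + e) l) => [|t /andP[tx _]]; last first.
  by rewrite step_right// mulr1.
rewrite integral_seg_cst ?mul0r ?add0r ?(ltW x0)//.
rewrite opprD addrACA subrr addr0 -RintegralB//.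
have int_le : \int[mu]_(t in `[x, x + e]) (`|g t * step x (x + e) t - g t|) <=
              \int[mu]_(t in `[x, x + e]) `|g t|.
  apply: integral_seg_le.
  - by apply: integrable_seg_norm; exact: integrable_segB.
  - exact: integrable_seg_norm.
  - move=> t _; rewrite -[X in _ - X]mulr1 -mulrBr normrM ler_piMr//.
    have /andP[s0 s1] := step_itv xe t.
    by rewrite ler0_norm ?subr_le0//; lra.
apply: (le_trans (le_normr_Rintegral _ _)) => //.
  exact: integrable_segB.
apply: (le_trans int_le); apply: ltW; apply: le_lt_trans (rP (x + e) _ _).
- exact: ler_norm.
- by rewrite /ball/= opprD addNKr normrN gtr0_norm.
- exact: ltW.
Qed.

(** On a bounded interval [|g| <= g ^ 2 + 1]. *)
Lemma integrable_sqr l g : 0 < l -> square_integrable l g ->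
  mu.-integrable `[0, l] (EFin \o g).
Proof.
move=> l0 [mg ig2].
have i1 : mu.-integrable `[0, l] (EFin \o (fun=> 1)) := integrable_cst_seg 0 l 1.
apply: (le_integrable _ _ _ (integrableD _ ig2 i1)) => //.
  exact/measurable_EFinP.
move=> t _ /=; rewrite lee_fin [leRHS]ger0_norm ?addr_ge0 ?sqr_ge0//.
rewrite -[g t ^+ 2]real_normK ?num_real//.
by have := sqr_ge0 (`|g t| - 1); have := sqr_ge0 `|g t|; nra.
Qed.

(** Testing the weak derivative with the difference of two mollified steps,
    one located at [x] and one at [y], and shrinking their width. *)
Lemma weak_derivative_increment l u g x y : 0 < x -> x < y -> y < l ->
  {within `[0, l], continuous u} -> square_integrable l g ->
  weak_derivative l u g -> u y - u x = \int[mu]_(t in `[x, y]) g t.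
Proof.
move=> x0 xy yl cu sg ug.
have l0 : 0 < l by apply: lt_trans yl; exact: lt_trans xy.
have ig := integrable_sqr l0 sg.
have xl := lt_trans xy yl; have y0 := lt_trans x0 xy.
suff small eta : 0 < eta ->
    `|u y - u x - \int[mu]_(t in `[x, y]) g t| <= eta.
  apply/eqP; rewrite -subr_eq0 -normr_eq0 eq_le normr_ge0 andbT.
  by apply/ler_addgt0Pl => eta eta0; rewrite addr0; exact: small.
move=> eta0; have e4 : 0 < eta / 4 by lra.
have [d1 d10 H1] := step_average (introT andP (conj x0 xl)) cu e4.
have [d2 d20 H2] := step_average (introT andP (conj y0 yl)) cu e4.
have [d3 d30 H3] := step_truncation (introT andP (conj x0 xl)) ig e4.
have [d4 d40 H4] := step_truncation (introT andP (conj y0 yl)) ig e4.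
pose d := Num.min (Num.min d1 d2) (Num.min d3 d4).
have d0 : 0 < d by rewrite !lt_min d10 d20 d30 d40.
pose e := d / 2; have e0 : 0 < e by rewrite /e; lra.
have : e < d by rewrite /e; lra.
rewrite !lt_min => /andP[/andP[ed1 ed2] /andP[ed3 ed4]].
have [xel {}H1] := H1 e (introT andP (conj e0 ed1)).
have [yel {}H2] := H2 e (introT andP (conj e0 ed2)).
have [_ {}H3] := H3 e (introT andP (conj e0 ed3)).
have [_ {}H4] := H4 e (introT andP (conj e0 ed4)).
have xxe : x < x + e by rewrite ltrDl.
have yye : y < y + e by rewrite ltrDl.
pose phi (t : R) : R := step x (x + e) t + (- 1) * step y (y + e) t.
have dphi (t : R) : is_derive t 1 phi
    (step_derivative x (x + e) t + (- 1) * step_derivative y (y + e) t).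
  have D1 := is_derive_step x (x + e) t.
  have D2 := is_derive1Z (- 1) (is_derive_step y (y + e) t).
  rewrite /phi; exact: (@is_derive1D _ (step x (x + e))
    (fun s => - 1 * step y (y + e) s) t _ _ D1 D2).
have tphi : test_function l phi.
  split.
    move=> n t; suff : smooth phi by move=> /(_ n.+1); apply.
    move=> k; apply: times_derivableD; first exact: smooth_step.
    by apply: times_derivableM; [exact: times_derivable_cst|exact: smooth_step].
  exists x, (y + e); split => // t.
  apply: contraNT; rewrite negb_and -!ltNge /phi => /orP[tx|yet].
    by rewrite !step_left ?mulr0 ?addr0// ltW// (lt_trans tx).
  rewrite !step_right ?mulr1 ?subrr// ltW// (lt_trans _ yet)// ltrD2r.
  exact: xy.
have := ug phi tphi.
have -> : derive1 phi = fun t =>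
    step_derivative x (x + e) t + (- 1) * step_derivative y (y + e) t.
  by apply/funext => t; rewrite derive1E; apply: derive_val; exact: dphi.
have isd a b : mu.-integrable `[0, l] (EFin \o (fun t => u t * step_derivative a b t)).
  apply: integrable_seg; apply: within_continuousM => //.
  by apply: continuous_subspaceT; exact: step_derivative_continuous.
have igs a b : a < b -> mu.-integrable `[0, l] (EFin \o (fun t => g t * step a b t)).
  by move=> ab; exact: integrable_mul_step.
rewrite [in X in X = _](@eq_integral_seg _ _ (fun t =>
    u t * step_derivative x (x + e) t - u t * step_derivative y (y + e) t));
  last by move=> t _; ring.
rewrite [in X in _ = - X](@eq_integral_seg _ _ (fun t =>
    g t * step x (x + e) t - g t * step y (y + e) t));
  last by move=> t _; rewrite /phi; ring.
rewrite RintegralB// RintegralB//; [|exact: igs..].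
have := @integral_seg_cat _ g x l y (ltW xy) (ltW yl).
move=> /(_ (integrable_sub (ltW x0) (lexx l) ig)).
move: H1 H2 H3 H4; rewrite !ler_norml.
set A1 := \int[mu]_(_ in _) _; set A2 := \int[mu]_(_ in _) _.
set A3 := \int[mu]_(_ in _) _; set A4 := \int[mu]_(_ in _) _.
set A5 := \int[mu]_(_ in _) _; set A6 := \int[mu]_(_ in _) _.
set A7 := \int[mu]_(_ in _) _.
lra.
Qed.

End WeakDerivative.

Section LowerIntegral.
Context d (T : measurableType d) (R : realType) (mu : {measure set T -> \bar R}).
Local Open Scope ereal_scope.
Import HBNNSimple.

(** The integral of a nonnegative function is the supremum of the integrals of
    the simple functions below it, so changing the integrand on a null set is
    harmless even if the result is no longer measurable. *)
Lemma integral_modification (D N : set T) (f g : T -> \bar R) :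
  measurable D -> measurable N -> mu N = 0 -> measurable_fun D g ->
  (forall x, D x -> 0 <= f x) -> (forall x, D x -> 0 <= g x) ->
  (forall x, D x -> ~ N x -> f x = g x) ->
  \int[mu]_(x in D) f x = \int[mu]_(x in D) g x.
Proof.
move=> mD mN N0 mg f0 g0 fg; have mTN : measurable (setT `\` N).
  exact: measurableD.
have mgD : measurable_fun setT (g \_ D).
  by apply/(measurable_restrictT _ _).1.
have gD0 x : 0 <= (g \_ D) x by exact: erestrict_ge0.
rewrite (ge0_integralE _ f0) (ge0_integralE _ g0); apply/eqP; rewrite eq_le.
apply/andP; split.
  apply: ge_ereal_sup => _ [h /= hf <-]; rewrite -integralT_nnsfun.
  have mh : measurable_fun setT (EFin \o h) by exact/measurable_EFinP.
  have h0 x : 0 <= (h x)%:E by rewrite lee_fin.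
  rewrite (ge0_negligible_integral mN measurableT mh (fun x _ => h0 x) N0).
  rewrite -(ge0_integralTE _ gD0).
  apply: (@le_trans _ _ (\int[mu]_(x in setT `\` N) (g \_ D) x)); last first.
    exact: ge0_subset_integral.
  apply: ge0_le_integral => //.
  - by move=> x _; exact: h0.
  - exact: measurable_funS mh.
  - exact: measurable_funS mgD.
  - move=> x [_ Nx]; apply: le_trans (hf x) _.
    by rewrite !patchE; case: ifPn => // /set_mem Dx; rewrite fg.
rewrite -(ge0_integralTE _ gD0) (ge0_negligible_integral mN measurableT mgD)//.
rewrite ge0_integralE//; apply: ereal_sup_le => _ [h /= hg <-]; exists h => //= x.
apply: le_trans (hg x) _; rewrite !patchE.
case: ifPn => [/set_mem [_ Nx]|_]; case: ifPn => // /set_mem Dx.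
- by rewrite fg.
- exact: f0.
Qed.

End LowerIntegral.

Section DerivativeAE.
Context {R : realType}.
Notation mu := (@lebesgue_measure R).
Implicit Types (u f g : R -> R) (l a b x y : R).

(** Interior points only: test functions vanish near the ends, so nothing is
    known there before continuity is used. *)
Definition increments_on l u g := forall x y, 0 < x -> x <= y -> y < l ->
  u y - u x = \int[mu]_(t in `[x, y]) g t.

(** By Lebesgue's differentiation theorem for the primitive of [g]. *)
Lemma derive1_ae l u g : mu.-integrable `[0, l] (EFin \o g) ->
  increments_on l u g ->
  {ae mu, forall x, 0 < x < l -> derive1 u x = g x}.
Proof.
move=> ig ug; pose f := g \_ `[0, l].
have iT : mu.-integrable setT (EFin \o f).
  by rewrite -restrict_EFin; apply/integrable_restrict => //=; rewrite setTI.
have iS y : mu.-integrable [set` Interval (BLeft 0) (BRight y)] (EFin \o f).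
  exact: integrableS iT.
have lf : locally_integrable [set: R] f by exact: integrable_locally.
have /= := FTC1 iS lf; apply: filterS.
  exact: (ae_filter_ringOfSetsType mu).
move=> x Hx /andP[x0 xl].
have [] := Hx _; first by rewrite lte_fin.
set F := (fun z : R => _) => dF F'.
have xf : f x = g x by rewrite /f patchE mem_set//= in_itv/= !ltW.
have dFx : is_derive x 1 F (g x).
  by apply: DeriveDef; [exact: dF|rewrite -derive1E F' xf].
have dFc : is_derive x 1 (fun z => F z + (u x - F x)) (g x).
  by have := is_derive1D dFx (is_derive_cst (u x - F x) x 1); rewrite addr0.
suff du : is_derive x 1 u (g x) by rewrite derive1E; exact: derive_val.
apply: (near_eq_is_derive _ dFc).
have segE a b : 0 < a -> a <= b -> b < l -> F b - F a = u b - u a.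
  move=> a0 ab bl; rewrite ug//.
  have ib : mu.-integrable `[0, b] (EFin \o f) := iS b.
  rewrite /F (integral_seg_cat (ltW a0) ab ib) addrAC subrr add0r.
  apply: eq_integral_seg => t /andP[at_ tb].
  by rewrite /f patchE mem_set//= in_itv/= (le_trans (ltW a0) at_) (le_trans tb (ltW bl)).
near=> z.
have z0 : 0 < z by near: z; exact: lt_nbhsr.
have zl : z < l by near: z; exact: lt_nbhsl.
have [xz|/ltW zx] := leP x z.
  by have := segE x z x0 xz zl; lra.
by have := segE z x z0 zx xl; lra.
Unshelve. all: by end_near. Qed.

(** The pointwise derivative takes arbitrary default values on a null set, so
    it is not known to be measurable; hence [integral_modification]. *)
Lemma integral_derive1_sqr l u g : 0 < l -> square_integrable l g ->
  increments_on l u g ->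
  \int[mu]_(x in `[0, l]) (`|derive1 u x| ^+ 2) = \int[mu]_(x in `[0, l]) (g x ^+ 2).
Proof.
move=> l0 sg ug; have ig := integrable_sqr l0 sg.
have [N [mN N0 subN]] := derive1_ae ig ug.
have mN' : measurable (N `|` [set 0; l]).
  by apply: measurableU => //; exact: measurableU.
rewrite /Rintegral; congr fine.
apply: (@integral_modification _ _ _ mu _ (N `|` [set 0; l])) => //.
- rewrite setUA measureU0//; last exact: lebesgue_measure_set1.
    by rewrite measureU0//; exact: lebesgue_measure_set1.
  exact: measurableU.
- by case: sg => mg ig2; exact: measurable_int ig2.
- by move=> x _; rewrite lee_fin sqr_ge0.
move=> x /=; rewrite in_itv/= => /andP[x0 xl] /not_orP[Nx /not_orP[x0' xl']].
rewrite real_normK ?num_real//; congr ((_ ^+ 2)%:E).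
have : ~ (~` [set x | 0 < x < l -> derive1 u x = g x]) x.
  by move=> /subN.
move=> /contrapT; apply.
rewrite !lt_neqAle x0 xl !andbT; apply/andP; split; apply/eqP => //.
exact: nesym.
Qed.

(** From [2 k g - k ^ 2 <= g ^ 2], integrated over [[a, b]]. *)
Lemma increment_sqr_bound l u g a b k : 0 < l -> square_integrable l g ->
  increments_on l u g -> 0 < a -> a <= b -> b < l ->
  2 * k * (u b - u a) - k ^+ 2 * (b - a) <= \int[mu]_(x in `[0, l]) (g x ^+ 2).
Proof.
move=> l0 sg ug a0 ab bl; have ig := integrable_sqr l0 sg.
have [mg ig2] := sg; rewrite ug//.
have iga := integrable_sub (ltW a0) (ltW bl) ig.
have ig2a := integrable_sub (ltW a0) (ltW bl) ig2.
rewrite -integral_seg_cst//.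
rewrite -RintegralZl// -RintegralB//; last 2 first.
- exact: integrable_segZ.
- exact: integrable_cst_seg.
apply: (@le_trans _ _ (\int[mu]_(x in `[a, b]) (g x ^+ 2))).
  apply: integral_seg_le => //.
    apply: integrable_segB; first exact: integrable_segZ.
    exact: integrable_cst_seg.
  by move=> t _; have := sqr_ge0 (g t - k); nra.
apply: fine_le.
- exact: integrable_fin_num.
- exact: integrable_fin_num.
apply: ge0_subset_integral => //.
- exact: measurable_int ig2.
- by move=> x _; rewrite lee_fin sqr_ge0.
- move=> x /=; rewrite !in_itv/= => /andP[ax xb].
  by rewrite (le_trans (ltW a0) ax) (le_trans xb (ltW bl)).
Qed.

End DerivativeAE.

Section H1Energy.
Context {R : realType}.
Notation mu := (@lebesgue_measure R).
Implicit Types (u f g : R -> R) (l a b x y : R).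

Lemma H1_interval_increments l u : {within `[0, l], continuous u} ->
  H1_interval l u -> exists2 g, square_integrable l g & increments_on l u g.
Proof.
move=> cu [_ [g sg ug]]; exists g => // x y x0; rewrite le_eqVlt.
move=> /predU1P[<- _|xy yl].
  by rewrite subrr set_itv1 Rintegral_set1.
exact: (weak_derivative_increment x0 xy yl cu sg ug).
Qed.

(** Bounds in the interior extend to the closed edge by continuity. *)
Lemma energy_bound_closure l u (E k : R) : 0 < l -> {within `[0, l], continuous u} ->
  (forall a b, 0 < a -> a <= b -> b < l ->
    2 * k * (u b - u a) - k ^+ 2 * (b - a) <= E) ->
  forall a b, 0 <= a -> a <= b -> b <= l ->
    2 * k * (u b - u a) - k ^+ 2 * (b - a) <= E.
Proof.
move=> l0 /(continuous_within_itvP _ l0)[_ u0 ul] H.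
have E0 : 0 <= E.
  have h0 : 0 < l / 2 by lra.
  have hl : l / 2 < l by lra.
  by have := H _ _ h0 (lexx _) hl; rewrite !subrr !mulr0 subr0.
have H0 b : 0 <= b -> b < l -> 2 * k * (u b - u 0) - k ^+ 2 * (b - 0) <= E.
  rewrite le_eqVlt => /predU1P[<- _|b0 bl].
    by rewrite !subrr !mulr0 subr0.
  have C : 2 * k * (u b - u a) - k ^+ 2 * (b - a) @[a --> 0^'+] -->
      2 * k * (u b - u 0) - k ^+ 2 * (b - 0).
    apply: cvgB; apply: cvgMr; apply: cvgB; try exact: cvg_cst; first exact: u0.
    by apply: cvg_at_right_filter; exact: cvg_id.
  apply: (cvgr_to_le C).
  near=> a; apply: H => //.
  by apply/ltW; near: a; exact: nbhs_right_lt.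
move=> a b a0 ab bl.
have Ha c : a <= c -> c < l -> 2 * k * (u c - u a) - k ^+ 2 * (c - a) <= E.
  move=> ac cl; move: a0; rewrite le_eqVlt => /predU1P[a0|a0].
    by rewrite -a0; apply: H0 => //; rewrite a0.
  exact: H.
move: bl; rewrite le_eqVlt => /predU1P[bl|bl]; last exact: Ha.
rewrite bl; move: ab; rewrite bl le_eqVlt => /predU1P[<-|al].
  by rewrite !subrr !mulr0 subr0.
have C : 2 * k * (u c - u a) - k ^+ 2 * (c - a) @[c --> l^'-] -->
    2 * k * (u l - u a) - k ^+ 2 * (l - a).
  apply: cvgB; apply: cvgMr; apply: cvgB; try exact: cvg_cst; first exact: ul.
  by apply: cvg_at_left_filter; exact: cvg_id.
apply: (cvgr_to_le C).
near=> c; apply: Ha; last by near: c; exact: nbhs_left_lt.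
by apply/ltW; near: c; exact: nbhs_left_gt.
Unshelve. all: by end_near. Qed.

(** What the energy functional retains of an [H1] function: its quadratic
    behaviour under scaling and its control of increments. *)
Lemma H1_interval_energy l u : 0 < l -> {within `[0, l], continuous u} ->
  H1_interval l u -> exists E : R, [/\
    forall c : R, \int[mu]_(x in `[0, l]) (`|derive1 (fun y => c * u y) x| ^+ 2) =
                  c ^+ 2 * E &
    forall a b k, 0 <= a -> a <= b -> b <= l ->
      2 * k * (u b - u a) - k ^+ 2 * (b - a) <= E].
Proof.
move=> l0 cu /(H1_interval_increments cu)[g sg ug].
exists (\int[mu]_(x in `[0, l]) (g x ^+ 2)); split.
  move=> c; have [mg ig2] := sg.
  have ig := integrable_sqr l0 sg.
  have iZ : mu.-integrable `[0, l] (EFin \o (fun x => (c * g x) ^+ 2)).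
    have := integrable_segZ (c ^+ 2) ig2; apply: eq_integrable => // x _.
    by rewrite /= exprMn.
  rewrite (@integral_derive1_sqr _ l (fun y => c * u y) (fun y => c * g y)) //.
  - rewrite -RintegralZl//; apply: eq_integral_seg => x _; exact: exprMn.
  - split; last exact: iZ.
    by apply: measurable_funM => //; exact: measurable_cst.
  - move=> x y x0 xy yl; rewrite -mulrBr ug// RintegralZl//.
    by apply: integrable_sub ig; exact: ltW.
move=> a b k; apply: energy_bound_closure => // a' b' a0 ab bl.
exact: increment_sqr_bound.
Qed.

End H1Energy.

(** * Signed powers and integrals over the graph *)

Section Powers.
Context {R : realType}.
Implicit Types (p q x : R).

(** Only the origin needs an argument, since [powR] is derivable on positive
    bases. *)
Lemma continuous_abs_powR q : 0 < q -> continuous (fun x : R => `|x| `^ q).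
Proof.
move=> q0 x; have [->|x0] := eqVneq x 0.
  apply/cvgrPdist_le => e e0; rewrite normr0 powR0 ?gt_eqF//.
  apply/nbhs_ballP; exists (e `^ q^-1); first exact: powR_gt0.
  move=> y; rewrite /ball/= sub0r normrN => /ltW ye.
  rewrite sub0r normrN ger0_norm ?powR_ge0//.
  have -> : e = (e `^ q^-1) `^ q.
    by rewrite -powRrM mulVf ?gt_eqF// powRr1// ltW.
  by apply: ge0_ler_powR; rewrite ?nnegrE ?powR_ge0// ltW.
have nx : 0 < `|x| by rewrite normr_gt0.
apply: (@continuous_comp _ _ _ (fun x : R => `|x|) (fun y => y `^ q)).
  exact: norm_continuous.
apply/differentiable_continuous/derivable1_diffP.
by apply: derivable_powR; rewrite in_itv/= nx.
Qed.

Definition signed_powR p x : R := `|x| `^ (p - 1) * x.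

Lemma continuous_signed_powR p : 1 < p -> continuous (signed_powR p).
Proof.
move=> p1 x; apply: cvgM; last exact: cvg_id.
by apply: continuous_abs_powR; rewrite subr_gt0.
Qed.

Lemma signed_powR_gt0 p x : 0 < x -> 0 < signed_powR p x.
Proof. by move=> x0; rewrite mulr_gt0// powR_gt0// normr_gt0 gt_eqF. Qed.

Lemma signed_powR_ge0 p x : 0 <= x -> 0 <= signed_powR p x.
Proof. by move=> x0; rewrite mulr_ge0// powR_ge0. Qed.

Lemma signed_powRN p x : signed_powR p (- x) = - signed_powR p x.
Proof. by rewrite /signed_powR normrN mulrN. Qed.

Lemma mul_signed_powR p x : 1 < p -> x * signed_powR p x = `|x| `^ (p + 1).
Proof.
move=> p1; have [->|x0] := eqVneq x 0.
  by rewrite mul0r normr0 powR0// gt_eqF//; lra.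
rewrite /signed_powR mulrCA -expr2 -real_normK ?num_real// -powR_mulrn//.
by rewrite -powRD ?normr_eq0 ?x0 ?implybT//; congr (_ `^ _); ring.
Qed.

Lemma ge0_signed_powR p x : 1 < p -> 0 <= x -> signed_powR p x = x `^ p.
Proof.
move=> p1 x0; rewrite /signed_powR ger0_norm// mulrC mulr_powRB1//; lra.
Qed.

Lemma ler_signed_powR p x y : 1 < p -> 0 <= x -> x <= y ->
  signed_powR p x <= signed_powR p y.
Proof.
move=> p1 x0 xy; have y0 := le_trans x0 xy.
by rewrite !ge0_signed_powR//; apply: ge0_ler_powR; rewrite ?nnegrE//; lra.
Qed.

End Powers.

Section GraphIntegral.
Context {R : realType} (G : graph_data R).
Notation mu := (@lebesgue_measure R).
Context (len0 : forall e : edge G, 0 < len e).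
Implicit Types (e : edge G) (u f g : edge G -> R -> R) (p : R).

Definition edgewise_continuous u :=
  forall e, {within `[0, len e], continuous (u e)}.

Definition edgewise_integrable f :=
  forall e, mu.-integrable `[0, len e] (EFin \o f e).

Lemma edgewise_continuous_integrable u :
  edgewise_continuous u -> edgewise_integrable u.
Proof. by move=> cu e; exact: integrable_seg. Qed.

Lemma edgewise_continuous_comp (h : R -> R) u : continuous h ->
  edgewise_continuous u -> edgewise_continuous (fun e x => h (u e x)).
Proof.
by move=> ch cu e x; apply: continuous_comp; [exact: cu|exact: ch].
Qed.

Lemma gint_le f g : edgewise_integrable f -> edgewise_integrable g ->
  (forall e x, 0 <= x <= len e -> f e x <= g e x) -> gint f <= gint g.
Proof.
by move=> fi gi fg; apply: ler_sum => e _; apply: integral_seg_le => // x; exact: fg.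
Qed.

Lemma eq_gint f g : (forall e x, 0 <= x <= len e -> f e x = g e x) ->
  gint f = gint g.
Proof. by move=> fg; apply: eq_bigr => e _; apply: eq_integral_seg => x; exact: fg. Qed.

Definition total_length : R := \sum_(e : edge G) len e.

Lemma gint_cst (c : R) : gint (fun (_ : edge G) (_ : R) => c) = c * total_length.
Proof.
rewrite /total_length mulr_sumr; apply: eq_bigr => e _.
by rewrite integral_seg_cst ?subr0// ltW.
Qed.

Lemma gintZ (c : R) f : edgewise_integrable f ->
  gint (fun e x => c * f e x) = c * gint f.
Proof.
by move=> fi; rewrite /gint mulr_sumr; apply: eq_bigr => e _; rewrite RintegralZl.
Qed.

Lemma gintB f g : edgewise_integrable f -> edgewise_integrable g ->
  gint (fun e x => f e x - g e x) = gint f - gint g.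
Proof.
by move=> fi gi; rewrite /gint -sumrB; apply: eq_bigr => e _; rewrite RintegralB.
Qed.

Lemma gint_ge0 f : (forall e x, 0 <= x <= len e -> 0 <= f e x) -> 0 <= gint f.
Proof.
move=> f0; apply: sumr_ge0 => e _; apply: Rintegral_ge0 => x /=.
by rewrite in_itv/=; exact: f0.
Qed.

Lemma gint_gt0 f (e0 : edge G) : edgewise_continuous f ->
  (forall e x, 0 <= x <= len e -> 0 < f e x) -> 0 < gint f.
Proof.
move=> cf f0; rewrite /gint (bigD1 e0)//=; apply: ltr_wpDr.
  apply: sumr_ge0 => e _; apply: Rintegral_ge0 => x /=.
  by rewrite in_itv/= => /f0/ltW.
have [c ce cmin] := EVT_min (ltW (len0 e0)) (cf e0).
apply: (@lt_le_trans _ _ (\int[mu]_(x in `[0, len e0]) f e0 c)).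
  by rewrite integral_seg_cst ?ltW// subr0 mulr_gt0// f0// -in_itv.
apply: integral_seg_le.
- exact: integrable_cst_seg.
- exact: integrable_seg.
- by move=> x xe; apply: cmin; rewrite in_itv.
Qed.

(** Otherwise [u] would be bounded below by a positive constant on each edge,
    and the integral would be positive. *)
Lemma exists_le0 p u (e0 : edge G) : 1 < p -> edgewise_continuous u ->
  gint (fun e x => signed_powR p (u e x)) = 0 ->
  exists e x, 0 <= x <= len e /\ u e x <= 0.
Proof.
move=> p1 cu u0; apply: contrapT => H.
have : 0 < gint (fun e x => signed_powR p (u e x)).
  apply: gint_gt0 => //.
    by apply: edgewise_continuous_comp cu; exact: continuous_signed_powR.
  move=> e x xe; apply: signed_powR_gt0; rewrite ltNge; apply/negP => ux.
  by apply: H; exists e, x.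
by rewrite u0 ltxx.
Qed.

Lemma exists_ge0 p u (e0 : edge G) : 1 < p -> edgewise_continuous u ->
  gint (fun e x => signed_powR p (u e x)) = 0 ->
  exists e x, 0 <= x <= len e /\ 0 <= u e x.
Proof.
move=> p1 cu u0.
have [||e [x [xe]]] := @exists_le0 p (fun e x => - u e x) e0 p1.
- by apply: edgewise_continuous_comp cu; exact: opp_continuous.
- have := @gintZ (- 1) _ (edgewise_continuous_integrable
    (edgewise_continuous_comp (continuous_signed_powR p1) cu)).
  rewrite u0 mulr0 => <-; apply: eq_gint => e x _.
  by rewrite signed_powRN mulN1r.
by rewrite oppr_le0; exists e, x.
Qed.

End GraphIntegral.

(** * Positivity of the least energy level *)

Section SigmaPositive.
Context {R : realType} (G : graph_data R).
Notation mu := (@lebesgue_measure R).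
Context (hG : compact_metric_graph G).
Context (acyc : without_cycles G).
Context (D : R) (e0 : edge G).
Context (D0 : 0 < D).
Context (hD : forall (e : edge G) x e' x', 0 <= x <= len e -> 0 <= x' <= len e' ->
  tree_dist e x e' x' <= D).
Implicit Types (e : edge G) (u : edge G -> R -> R) (p t : R).

Lemma total_length_gt0 : 0 < total_length G.
Proof.
rewrite /total_length (bigD1 e0)//= ltr_pwDl ?len_gt0//.
by apply: sumr_ge0 => e _; apply/ltW/len_gt0.
Qed.

(** A function with vanishing signed mean takes values of both signs, so its
    values are bounded by its oscillation. *)
Lemma sup_norm_bound p u (E : edge G -> R) : 1 < p -> gcontinuous u ->
  (forall f a b k, 0 <= a -> a <= b -> b <= len f ->
     2 * k * (u f b - u f a) - k ^+ 2 * (b - a) <= E f) ->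
  gint (fun e x => signed_powR p (u e x)) = 0 ->
  forall e x, 0 <= x <= len e -> u e x ^+ 2 <= \sum_f E f * D.
Proof.
move=> p1 [cu uV] uE u0 e x xe.
have E0 : 0 <= \sum_f E f.
  apply: sumr_ge0 => f _; have l0 := ltW (len_gt0 hG f).
  by have := uE f 0 0 0 (lexx 0) (lexx 0) l0; rewrite !subrr !mulr0 subr0.
have bound f y : 0 <= y <= len f -> (u e x - u f y) ^+ 2 <= \sum_f E f * D.
  move=> yf; rewrite -mulr_suml.
  apply: le_trans (increment_energy_bound hG acyc uV uE xe yf) _.
  by rewrite -mulr_suml ler_wpM2l// hD.
have [f [y [yf uy]]] := exists_le0 (len_gt0 hG) e0 p1 cu u0.
have [g [z [zg uz]]] := exists_ge0 (len_gt0 hG) e0 p1 cu u0.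
have [ux|ux] := leP 0 (u e x).
  by apply: le_trans (bound f y yf); nra.
by apply: le_trans (bound g z zg); nra.
Qed.

(** The scaling of the energy is recorded as a property because the pointwise
    derivative commutes with scaling only where it exists. *)
Definition energy_scales u (A : R) := forall c,
  gint (fun e x => `|derive1 (fun y => c * u e y) x| ^+ 2) = c ^+ 2 * A.

Lemma H1_energy u : H1 u -> exists E : edge G -> R,
  energy_scales u (\sum_f E f) /\
  (forall f a b k, 0 <= a -> a <= b -> b <= len f ->
     2 * k * (u f b - u f a) - k ^+ 2 * (b - a) <= E f).
Proof.
move=> [[cu _] hu].
have /choice[E HE] : forall e, exists E : R,
    (forall c : R, \int[mu]_(x in `[0, len e]) (`|derive1 (fun y => c * u e y) x| ^+ 2) =
                  c ^+ 2 * E) /\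
    (forall a b k, 0 <= a -> a <= b -> b <= len e ->
      2 * k * (u e b - u e a) - k ^+ 2 * (b - a) <= E).
  move=> e; have [E [h1 h2]] := H1_interval_energy (len_gt0 hG e) (cu e) (hu e).
  by exists E.
exists E; split; last by move=> f; exact: (HE f).2.
move=> c; rewrite mulr_sumr; apply: eq_bigr => e _; exact: (HE e).1.
Qed.

Lemma edgewise_integrable_powR p u : 0 < p -> edgewise_continuous u ->
  edgewise_integrable (fun e x => `|u e x| `^ p).
Proof.
move=> p0 cu; apply: edgewise_continuous_integrable.
exact: (edgewise_continuous_comp (continuous_abs_powR p0) cu).
Qed.

Lemma J_scale p u A t : 1 < p -> edgewise_continuous u -> energy_scales u A ->
  0 < t -> J p (fun e x => t * u e x) =
    2^-1 * (t ^+ 2 * A) -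
    (p + 1)^-1 * (t `^ (p + 1) * gint (fun e x => `|u e x| `^ (p + 1))).
Proof.
move=> p1 cu uA t0; rewrite /J uA -gintZ; last first.
  by apply: edgewise_integrable_powR => //; lra.
congr (_ - _ * _); apply: eq_gint => e x _.
by rewrite normrM gtr0_norm// powRM// ltW.
Qed.

(** With [|u| ^ 2 <= A D], a multiple of [u] with sup norm at most [s] has
    energy at least [s ^ 2 / (2 D) - s ^ (p + 1) |G| / (p + 1)].  Choosing [s]
    so that the second term is half of the first gives a positive bound that
    does not depend on [u]. *)
Lemma sigma_gt0 p : 1 < p -> (0 < sigma G p)%E.
Proof.
move=> p1; have L0 := total_length_gt0.
have q0 : 0 < p - 1 by rewrite subr_gt0.
pose K := (p + 1) / (4 * D * total_length G).
have K0 : 0 < K by rewrite divr_gt0 ?mulr_gt0//; lra.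
pose s := K `^ (p - 1)^-1; have s0 : 0 < s by exact: powR_gt0.
pose c := s ^+ 2 / (4 * D).
have c0 : 0 < c by rewrite divr_gt0 ?exprn_gt0 ?mulr_gt0.
apply: (@lt_le_trans _ _ c%:E); first by rewrite lte_fin.
apply: le_ereal_inf_tmp => _ [u [[gu Hu] [z uz] u0] <-].
have [E [EA Eb]] := H1_energy (conj gu Hu).
have sup := sup_norm_bound p1 gu Eb u0.
set A := \sum_f E f in EA.
have {}sup e x : 0 <= x <= len e -> u e x ^+ 2 <= A * D.
  by move=> xe; rewrite /A mulr_suml; exact: sup.
have AD0 : 0 < A * D.
  by apply: lt_le_trans (sup _ _ (pcoordP z)); rewrite exprn_even_gt0.
have A0 : 0 < A by rewrite -(pmulr_lgt0 _ D0).
(* [r] bounds the sup norm of [u], and [s / r] scales it down to [s]. *)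
pose r := Num.sqrt (A * D); have r0 : 0 < r by rewrite sqrtr_gt0.
have r2 : r ^+ 2 = A * D by rewrite sqr_sqrtr// ltW.
pose t := s / r; have t0 : 0 < t by rewrite divr_gt0.
apply: le_trans (ereal_sup_ubound _); last by exists t => //; exact: t0.
rewrite lee_fin (J_scale p1 gu.1 EA t0) -gintZ; last first.
  by apply: edgewise_integrable_powR gu.1; lra.
have B : gint (fun e x => t `^ (p + 1) * `|u e x| `^ (p + 1)) <=
    s `^ (p + 1) * total_length G.
  rewrite -(gint_cst (len_gt0 hG)); apply: gint_le.
  - move=> e; apply: integrable_segZ; apply: edgewise_integrable_powR gu.1 e; lra.
  - by move=> e; exact: integrable_cst_seg.
  move=> e x xe; rewrite -powRM ?normr_ge0 ?(ltW t0)//.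
  have ur : `|u e x| <= r.
    by rewrite -(ler_pXn2r (_ : 0 < 2)%N) ?nnegrE ?(ltW r0)// r2 real_normK ?num_real// sup.
  apply: ge0_ler_powR; rewrite ?nnegrE ?mulr_ge0 ?normr_ge0 ?(ltW t0) ?(ltW s0) ?invr_ge0 ?(ltW r0)//; first lra.
  by rewrite /t mulrAC ler_pdivrMr// ler_pM2l.
have sK : s `^ (p + 1) = K * s ^+ 2.
  have -> : p + 1 = (p - 1) + 2 by ring.
  rewrite powRD; last by rewrite (gt_eqF s0) implybT.
  rewrite (powR_mulrn 2) ?ltW//; congr (_ * _).
  by rewrite /s -powRrM mulVf ?gt_eqF// powRr1// ltW.
apply: (@le_trans _ _ (2^-1 * (t ^+ 2 * A) - (p + 1)^-1 * (s `^ (p + 1) * total_length G))).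
  have -> : 2^-1 * (t ^+ 2 * A) = 2 * c.
    rewrite /t expr_div_n r2 /c; field.
    by rewrite !gt_eqF.
  rewrite sK (_ : (p + 1)^-1 * _ = c) 1?lerBrDr; first lra.
  rewrite /K /c; field; rewrite !gt_eqF//; lra.
rewrite lerD2l lerN2 ler_pM2l//.
by rewrite invr_gt0; lra.
Qed.

End SigmaPositive.

(** * Affine functions and the fibres of the energy *)

Section Affine.
Context {R : realType}.
Notation mu := (@lebesgue_measure R).
Implicit Types (a s l x : R).

Lemma continuous_affine a s : continuous (fun x : R => a + s * x).
Proof.
move=> x; apply: cvgD; first exact: cvg_cst.
by apply: cvgMr; exact: cvg_id.
Qed.

Lemma is_derive_affine a s x : is_derive x 1 (fun x : R => a + s * x) s.
Proof.
have := is_derive1_affine s a x; congr is_derive.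
by apply/funext => y; rewrite addrC.
Qed.

Lemma within_continuous (f : R -> R) l : continuous f -> {within `[0, l], continuous f}.
Proof. exact: continuous_subspaceT. Qed.

Lemma square_integrable_continuous l (f : R -> R) : continuous f ->
  square_integrable l f.
Proof.
move=> cf; split.
  by apply: measurable_funTS; exact: continuous_measurable_fun.
apply: integrable_seg; apply: within_continuous => x.
by apply: (@continuous_comp _ _ _ f (fun y => y ^+ 2)); [exact: cf|exact: exprn_continuous].
Qed.

(** Integration by parts against a test function, which vanishes at both ends. *)
Lemma H1_interval_affine a s l : 0 < l -> H1_interval l (fun x => a + s * x).
Proof.
move=> l0; split; first by apply: square_integrable_continuous; exact: continuous_affine.
exists (fun=> s); first by apply: square_integrable_continuous; exact: cst_continuous.
move=> phi [dphi [b [c [b0 cl supp]]]].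
have phi0 x : ~~ (b <= x <= c) -> phi x = 0.
  by apply: contraNeq => /supp.
have d1 x : derivable phi x 1 := dphi 0%N x.
have cphi : continuous phi.
  by move=> x; apply/differentiable_continuous/derivable1_diffP.
have cdphi : continuous (derive1 phi).
  by move=> x; apply/differentiable_continuous/derivable1_diffP; exact: (dphi 1%N x).
rewrite (@Rintegration_by_parts R (fun x => a + s * x) phi (fun=> s) (derive1 phi) 0 l l0).
- rewrite !phi0 ?mulr0 ?subr0 ?sub0r//.
    by rewrite negb_and -!ltNge b0.
  by rewrite negb_and -!ltNge cl orbT.
- by apply: within_continuous; exact: cst_continuous.
- split.
  + by move=> x _; have [] := is_derive_affine a s x.
  + by apply/cvg_at_right_filter; exact: continuous_affine.
  + by apply/cvg_at_left_filter; exact: continuous_affine.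
- by move=> x _; rewrite derive1E; apply: derive_val; exact: is_derive_affine.
- exact: within_continuous.
- split.
  + by move=> x _; exact: d1.
  + by apply/cvg_at_right_filter; exact: cphi.
  + by apply/cvg_at_left_filter; exact: cphi.
- by [].
Qed.

(** Within distance [d] of an end where it is at least [1] in absolute value,
    a function of slope at most [eps / d] stays above [1 - eps]. *)
Lemma affine_powR_lower a s l z d eps q : 0 < q -> 0 < d -> d <= l ->
  0 < eps < 1 -> `|s| * d <= eps -> z = 0 \/ z = l -> 1 <= `|a + s * z| ->
  d * (1 - eps) `^ q <= \int[mu]_(x in `[0, l]) (`|a + s * x| `^ q).
Proof.
move=> q0 d0 dl /andP[eps0 eps1] sd zl uz.
have cu : continuous (fun x : R => `|a + s * x| `^ q).
  move=> x; apply: (@continuous_comp _ _ _ (fun x => a + s * x) (fun y => `|y| `^ q)).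
    exact: continuous_affine.
  exact: continuous_abs_powR.
have sub b : 0 <= b -> b + d <= l -> (forall x, b <= x <= b + d -> `|x - z| <= d) ->
    d * (1 - eps) `^ q <= \int[mu]_(x in `[0, l]) (`|a + s * x| `^ q).
  move=> b0 bl bz.
  have bd : b <= b + d by rewrite lerDl ltW.
  have i0 : mu.-integrable `[0, l] (EFin \o (fun x : R => `|a + s * x| `^ q)).
    by apply: integrable_seg; exact: within_continuous.
  have ib := integrable_sub (lexx 0) bl i0.
  rewrite (integral_seg_cat (le_trans b0 bd) bl i0) (integral_seg_cat b0 bd ib).
  apply: (@le_trans _ _ (\int[mu]_(x in `[b, b + d]) (`|a + s * x| `^ q))); last first.
    rewrite -[leLHS]add0r -[leLHS]addr0 lerD ?lerD//;
      by apply: Rintegral_ge0 => x _; exact: powR_ge0.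
  have -> : d * (1 - eps) `^ q = \int[mu]_(x in `[b, b + d]) ((1 - eps) `^ q).
    by rewrite integral_seg_cst// addrAC subrr add0r mulrC.
  apply: integral_seg_le.
  - exact: integrable_cst_seg.
  - exact: integrable_sub i0.
  move=> x xb; apply: ge0_ler_powR; rewrite ?nnegrE ?normr_ge0 ?subr_ge0 ?(ltW q0) ?(ltW eps1)//.
  have h1 : `|s * (x - z)| <= eps.
    by rewrite normrM; apply: le_trans sd; rewrite ler_wpM2l// bz.
  have h2 := ler_normD (a + s * x) (- (s * (x - z))).
  rewrite normrN (_ : a + s * x - s * (x - z) = a + s * z) in h2; last by ring.
  lra.
case: zl => zE; rewrite zE in sub.
  apply: (sub 0); rewrite ?add0r// => x /andP[x0 xd].
  by rewrite subr0 ger0_norm.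
apply: (sub (l - d)); rewrite ?subr_ge0 ?subrK// => x /andP[x0 xd].
by rewrite ler0_norm; lra.
Qed.

End Affine.

Section Bernoulli.
Context {R : realType}.
Implicit Types (p q z t A B : R).

(** Young's inequality for the product [z * 1]. *)
Lemma bernoulli_powR q z : 1 < q -> 0 <= z -> q * z - q + 1 <= z `^ q.
Proof.
move=> q1 z0; have q0 : 0 < q by lra.
have q10 : 0 < q - 1 by lra.
have := @conjugate_powR R z 1 q (q / (q - 1)) z0 ler01 q0 (divr_gt0 q0 q10).
rewrite powR1 mulr1 invf_div mul1r => H.
have : z <= z `^ q / q + (q - 1) / q.
  by apply: H; field; rewrite gt_eqF.
rewrite -mulrDl ler_pdivlMr//; lra.
Qed.

(** The left-hand side is [J p (t u)] for a function with Dirichlet energy [A]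
    and [\int |u| ^ (p + 1) = B], and the right-hand side is its maximum over
    [t], attained at [t ^ (p - 1) = A / B]. *)
Lemma fibre_le p A B t : 1 < p -> 0 < A -> 0 < B -> 0 < t ->
  2^-1 * (t ^+ 2 * A) - (p + 1)^-1 * (t `^ (p + 1) * B) <=
  (2^-1 - (p + 1)^-1) * (A * (A / B) `^ (2 / (p - 1))).
Proof.
move=> p1 A0 B0 t0.
have AB : 0 < A / B by rewrite divr_gt0.
set y := (A / B) `^ _; have y0 : 0 < y by exact: powR_gt0.
pose q := (p + 1) / 2; have q1 : 1 < q by rewrite /q; lra.
pose z := t ^+ 2 / y; have z0 : 0 < z by rewrite divr_gt0// exprn_gt0.
(* [y] is the square of the maximiser, so that [z] measures [t] against it. *)
have yq : y `^ q = y * (A / B).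
  have -> : q = 1 + (p - 1) / 2 by rewrite /q; lra.
  rewrite powRD; last by rewrite (gt_eqF y0) implybT.
  rewrite powRr1 ?ltW//; congr (_ * _).
  rewrite /y -powRrM (_ : 2 / (p - 1) * ((p - 1) / 2) = 1) ?powRr1 ?ltW//.
  by field; rewrite subr_eq0 gt_eqF.
have tq : t `^ (p + 1) * B = z `^ q * (y * A).
  have -> : t `^ (p + 1) = (t ^+ 2) `^ q.
    rewrite -powR_mulrn ?ltW// -powRrM; congr (_ `^ _).
    by rewrite /q; field.
  have -> : t ^+ 2 = z * y by rewrite /z divfK// gt_eqF.
  by rewrite powRM ?ltW// yq; field; rewrite gt_eqF.
rewrite tq (_ : t ^+ 2 = z * y); last by rewrite /z divfK// gt_eqF.
have yA : 0 < y * A by rewrite mulr_gt0.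
have := bernoulli_powR q1 (ltW z0) => H.
have {}H : 2^-1 * z - (p + 1)^-1 * z `^ q <= 2^-1 - (p + 1)^-1.
  have -> : 2^-1 * z - (p + 1)^-1 * z `^ q = (p + 1)^-1 * (q * z - z `^ q).
    by rewrite /q; field; rewrite gt_eqF; lra.
  have -> : 2^-1 - (p + 1)^-1 = (p + 1)^-1 * (q - 1).
    by rewrite /q; field; rewrite gt_eqF; lra.
  by rewrite ler_pM2l ?invr_gt0; lra.
have -> : 2^-1 * (z * y * A) - (p + 1)^-1 * (z `^ q * (y * A)) =
   (2^-1 * z - (p + 1)^-1 * z `^ q) * (y * A) by ring.
by rewrite [A * y]mulrC ler_pM2r.
Qed.

End Bernoulli.

(** * The tent over a diameter *)

Lemma norm_signed_powR (R : realType) (p x : R) :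
  `|signed_powR p x| = signed_powR p `|x|.
Proof. by rewrite /signed_powR normrM normr_id ger0_norm ?powR_ge0. Qed.

Section TestFunction.
Context {R : realType} (G : graph_data R).
Notation mu := (@lebesgue_measure R).
Context (hG : compact_metric_graph G).
Context (acyc : without_cycles G).
Context (v w : vertex G).
Context (D0 : 0 < vdist v w).
Implicit Types (e f : edge G) (p c x : R).

Let D := vdist v w.

(** [1] or [- 1] on the edges of the path from [v] to [w], according to their
    orientation, and [0] elsewhere. *)
Definition slope f : R := (vcoord f w - vcoord f v) / len f.

(** Increases from [- 1] to [1] with slope [2 / D] along the path from [v] to
    [w], and is constant on the branches off the path. *)
Definition tent e x : R :=
  - 1 + 2 / D * \sum_f slope f * (edge_coord f e x - vcoord f v).

Let len_neq0 f : len f != 0.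
Proof. by rewrite gt_eqF// (len_gt0 hG). Qed.

Lemma slope_cases f : [\/ slope f = 0 /\ vcoord f w = vcoord f v,
   [/\ slope f = 1, vcoord f v = 0 & vcoord f w = len f] |
   [/\ slope f = - 1, vcoord f v = len f & vcoord f w = 0] ].
Proof.
rewrite /slope /vcoord; case: (side f v); case: (side f w).
- by constructor 1; rewrite subrr mul0r.
- by constructor 2; rewrite subr0 divff ?len_neq0.
- by constructor 3; rewrite sub0r mulNr divff ?len_neq0.
- by constructor 1; rewrite subrr mul0r.
Qed.

Lemma tent_term_itv f e x : 0 <= x <= len e ->
  0 <= slope f * (edge_coord f e x - vcoord f v) <= `|vcoord f v - vcoord f w|.
Proof.
move=> /(coord_itv hG f)/andP[c0 cl].
have [[-> ->]|[-> -> ->]|[-> -> ->]] := slope_cases f.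
- by rewrite mul0r subrr normr0 lexx.
- by rewrite mul1r subr0 sub0r normrN ger0_norm ?c0// (le_trans c0).
- rewrite subr0 ger0_norm ?(ltW (len_gt0 hG f))//; apply/andP; split; lra.
Qed.

Lemma tent_itv e x : 0 <= x <= len e -> - 1 <= tent e x <= 1.
Proof.
move=> xe.
have S0 : 0 <= \sum_f slope f * (edge_coord f e x - vcoord f v).
  by apply: sumr_ge0 => f _; have /andP[] := tent_term_itv f xe.
have SD : \sum_f slope f * (edge_coord f e x - vcoord f v) <= D.
  by apply: ler_sum => f _; have /andP[] := tent_term_itv f xe.
rewrite /tent; have d0 : 0 <= 2 / D by rewrite divr_ge0// ltW.
rewrite lerDl mulr_ge0//=.
have : 2 / D * (\sum_f slope f * (edge_coord f e x - vcoord f v)) <= 2 / D * D.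
  by rewrite ler_wpM2l.
by rewrite divfK ?gt_eqF//; lra.
Qed.

Lemma tent_vertex e x a : at_vertex e x a ->
  tent e x = - 1 + 2 / D * \sum_f slope f * (vcoord f a - vcoord f v).
Proof.
move=> ha; rewrite /tent; congr (_ + _ * _); apply: eq_bigr => f _.
by rewrite (coord_vertex hG acyc f ha).
Qed.

Lemma tent_affine e x : tent e x = tent e 0 + (2 / D * slope e) * x.
Proof.
suff E : \sum_f slope f * (edge_coord f e x - vcoord f v) =
    \sum_f slope f * (edge_coord f e 0 - vcoord f v) + slope e * x.
  by rewrite /tent E; ring.
rewrite (bigD1 e)//= [in RHS](bigD1 e)//= /edge_coord eqxx.
under eq_bigr => f fe do rewrite eq_sym (negbTE fe).
under [in RHS]eq_bigr => f fe do rewrite eq_sym (negbTE fe).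
ring.
Qed.

Lemma tent_v e x : at_vertex e x v -> tent e x = - 1.
Proof.
move=> /tent_vertex ->; rewrite big1 ?mulr0 ?addr0// => f _.
by rewrite subrr mulr0.
Qed.

Lemma tent_w e x : at_vertex e x w -> tent e x = 1.
Proof.
move=> /tent_vertex ->; rewrite (_ : \sum_f _ = D).
  by rewrite divfK ?gt_eqF//; lra.
rewrite /D /vdist; apply: eq_bigr => f _.
have l0 := len_gt0 hG f.
have [[-> ->]|[-> -> ->]|[-> -> ->]] := slope_cases f.
- by rewrite mul0r subrr normr0.
- by rewrite mul1r subr0 sub0r normrN gtr0_norm.
- by rewrite subr0 gtr0_norm//; lra.
Qed.

(** The path has length [D] and the slope along it is [2 / D]. *)
Lemma tent_energy : \sum_e (2 / D * slope e) ^+ 2 * len e = 4 / D.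
Proof.
have -> : 4 / D = (2 / D) ^+ 2 * \sum_f `|vcoord f v - vcoord f w|.
  by rewrite -/(vdist v w) -/D; field; rewrite gt_eqF.
rewrite mulr_sumr; apply: eq_bigr => f _; rewrite exprMn -mulrA; congr (_ * _).
have l0 := len_gt0 hG f.
have [[-> ->]|[-> -> ->]|[-> -> ->]] := slope_cases f.
- by rewrite expr0n mul0r subrr normr0.
- by rewrite expr1n mul1r sub0r normrN gtr0_norm.
- by rewrite sqrrN expr1n mul1r subr0 gtr0_norm.
Qed.

Lemma norm_slope_le f : `|slope f| <= 1.
Proof.
by have [[-> _]|[-> _ _]|[-> _ _]] := slope_cases f;
  rewrite ?normrN ?normr0 ?normr1 ?ler01.
Qed.

Lemma tent_shift_affine c e : (fun x => tent e x + c) =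
  (fun x => (tent e 0 + c) + (2 / D * slope e) * x).
Proof. by apply/funext => x; rewrite tent_affine; ring. Qed.

Lemma tent_shift_continuous c e : continuous (fun x => tent e x + c).
Proof. by rewrite tent_shift_affine; exact: continuous_affine. Qed.

Lemma H1_tent_shift c : H1 (fun e x => tent e x + c).
Proof.
split; last first.
  by move=> e; rewrite tent_shift_affine; apply: H1_interval_affine; exact: len_gt0.
split; first by move=> e; apply: within_continuous; exact: tent_shift_continuous.
by move=> a e x e' x' ha ha'; rewrite (tent_vertex ha) (tent_vertex ha').
Qed.

Lemma tent_energy_scales c : energy_scales (fun e x => tent e x + c) (4 / D).
Proof.
move=> k; rewrite -tent_energy mulr_sumr; apply: eq_bigr => e _.
rewrite (@eq_integral_seg _ _ (fun=> (k * (2 / D * slope e)) ^+ 2)).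
  rewrite integral_seg_cst ?subr0; last exact/ltW/len_gt0.
  by ring.
move=> x _; rewrite real_normK ?num_real//; congr (_ ^+ 2).
rewrite derive1E; apply: derive_val.
apply: (@is_derive1Z _ k (fun y => tent e y + c)).
by rewrite tent_shift_affine; exact: is_derive_affine.
Qed.

(** The signed mean is continuous in the shift [c], nonpositive at [c = - 1] and
    nonnegative at [c = 1], as the tent has values in [[- 1, 1]]. *)
Lemma exists_balancing_shift p : 1 < p -> exists2 c, - 1 <= c <= 1 &
  gint (fun e x => signed_powR p (tent e x + c)) = 0.
Proof.
move=> p1; pose F c := gint (fun e x => signed_powR p (tent e x + c)).
have cF : {in `]- 2, 2[, continuous F}.
  move=> c c2; rewrite /continuous_at /F /gint.
  apply: cvg_big => [|e _]; first exact: add_continuous.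
  have cont x : continuous (fun c => signed_powR p (tent e x + c)).
    move=> z; apply: (@continuous_comp _ _ _ (fun c => tent e x + c) (signed_powR p)).
      by apply: cvgD; [exact: cvg_cst|exact: cvg_id].
    exact: continuous_signed_powR.
  (* The tent plus a shift from [`]- 2, 2[] stays within [- 3] and [3]. *)
  apply: (@continuity_under_integral R _ _ mu
    (fun c x => signed_powR p (tent e x + c)) `[0, len e]%classic _ (- 2) 2
    _ _ (fun=> signed_powR p 3)) => //.
  - move=> z _; apply: integrable_seg; apply: within_continuous => x.
    apply: (@continuous_comp _ _ _ (fun x => tent e x + z) (signed_powR p)).
      exact: tent_shift_continuous.
    exact: continuous_signed_powR.
  - by apply: aeW => x _ z _; exact: cont.
  - exact: integrable_cst_seg.
  - move=> z; rewrite /= in_itv/= => /andP[z1 z2]; apply: aeW => x.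
    rewrite /= in_itv/= => /tent_itv/andP[t1 t2].
    rewrite norm_signed_powR; apply: ler_signed_powR => //.
    by rewrite ler_norml; apply/andP; split; lra.
  by rewrite inE.
have cFw : {within `[- 1, 1], continuous F}.
  apply: continuous_in_subspaceT => z; rewrite inE/= in_itv/= => /andP[z1 z2].
  by apply: cF; rewrite in_itv/=; apply/andP; split; lra.
have rangeF : Order.min (F (- 1)) (F 1) <= 0 <= Order.max (F (- 1)) (F 1).
  have Fm : F (- 1) <= 0.
    have : 0 <= gint (fun e x => - 1 * signed_powR p (tent e x + - 1)).
      apply: gint_ge0 => e x /tent_itv/andP[_ t1].
      by rewrite mulN1r -signed_powRN; apply: signed_powR_ge0; lra.
    rewrite gintZ ?mulN1r ?oppr_ge0//.
    apply: edgewise_continuous_integrable => e; apply: within_continuous => x.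
    apply: (@continuous_comp _ _ _ (fun x => tent e x + - 1) (signed_powR p)).
      exact: tent_shift_continuous.
    exact: continuous_signed_powR.
  have Fp : 0 <= F 1.
    by apply: gint_ge0 => e x /tent_itv/andP[t1 _]; apply: signed_powR_ge0; lra.
  by rewrite ge_min Fm le_max Fp orbT.
have m11 : (- 1 : R) <= 1 by lra.
have [z] := IVT m11 cFw rangeF.
by rewrite in_itv/= => z1 Fz; exists z.
Qed.

(** Whatever the shift, one end of the path keeps absolute value at least [1],
    and slopes of at most [2 / D] preserve [1 - eps] nearby.  It matters that
    [d] depends neither on [p] nor on the shift. *)
Lemma tent_powR_lower eps : 0 < eps < 1 -> exists2 d, 0 < d &
  forall p c, 1 < p ->
    (exists x : gpoint G, tent (pedge x) (pcoord x) + c != 0) /\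
    d * (1 - eps) `^ (p + 1) <= gint (fun e x => `|tent e x + c| `^ (p + 1)).
Proof.
move=> eps01; have /andP[eps0 eps1] := eps01.
have [ev hv] := exists_incident hG v; have [ew hw] := exists_incident hG w.
pose d := Num.min (eps * D / 2) (Num.min (len ev) (len ew)).
have d0 : 0 < d.
  by rewrite !lt_min !(len_gt0 hG) !andbT divr_gt0// mulr_gt0.
exists d => // p c p1.
have far e a : incident e a -> d <= len e -> 1 <= `|tent e (end_coord e a) + c| ->
    (exists x : gpoint G, tent (pedge x) (pcoord x) + c != 0) /\
    d * (1 - eps) `^ (p + 1) <= gint (fun e x => `|tent e x + c| `^ (p + 1)).
  move=> ea dle h; split.
    exists (GPoint (end_coord_itv hG e a)) => /=.
    by rewrite -normr_gt0; apply: lt_le_trans h.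
  rewrite /gint (bigD1 e)//= -[leLHS]addr0; apply: lerD; last first.
    apply: sumr_ge0 => f _; apply: Rintegral_ge0 => x _; exact: powR_ge0.
  rewrite (@eq_integral_seg _ _
    (fun x => `|(tent e 0 + c) + (2 / D * slope e) * x| `^ (p + 1))) => [|x _]; last first.
    by rewrite [tent e x]tent_affine; congr (`|_| `^ _); ring.
  apply: (@affine_powR_lower _ _ _ _ (end_coord e a)) => //.
  - lra.
  - rewrite normrM ger0_norm ?divr_ge0// ?(ltW D0)//.
    have dD : d <= eps * D / 2 by rewrite ge_min lexx.
    have r0 : 0 < 2 / D by rewrite divr_gt0.
    have -> : eps = 2 / D * (eps * D / 2) by field; rewrite gt_eqF.
    apply: (@le_trans _ _ (2 / D * d)); last by rewrite ler_pM2l.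
    by rewrite ler_pM2r// ler_piMr ?norm_slope_le// ltW.
  - by rewrite /end_coord; case: ifP; [left|right].
  - by rewrite -addrA [c + _]addrC addrA -tent_affine.
(* The shift raises the value at [w] or lowers the value at [v]. *)
have [c0|c0] := leP 0 c.
  apply: (far ew w hw); first by rewrite !ge_min lexx !orbT.
  by rewrite (tent_w (at_end_coord hw)) ger0_norm; lra.
apply: (far ev v hv); first by rewrite !ge_min lexx !orbT.
by rewrite (tent_v (at_end_coord hv)) ltr0_norm; lra.
Qed.

(** The bound of [fibre_le] decreases in [B], here replaced by its lower bound
    from [tent_powR_lower]. *)
Lemma sigma_upper_bound eps : 0 < eps < 1 -> exists2 d, 0 < d &
  forall p, 1 < p -> (sigma G p <=
    ((2^-1 - (p + 1)^-1) *
     (4 / D * (4 / D / (d * (1 - eps) `^ (p + 1))) `^ (2 / (p - 1))))%:E)%E.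
Proof.
move=> eps01; have /andP[eps0 eps1] := eps01.
have [d d0 H] := tent_powR_lower eps01; exists d => // p p1.
have [c _ cp] := exists_balancing_shift p1.
have [nz B] := H p c p1.
have cu : edgewise_continuous (fun e x => tent e x + c).
  by move=> e; apply: within_continuous; exact: tent_shift_continuous.
apply: ge_ereal_inf; exists (ereal_sup
    [set (J p (fun e x => t * (tent e x + c)))%:E | t in [set t : R | 0 < t]]).
  by exists (fun e x => tent e x + c) => //; split => //; exact: H1_tent_shift.
apply: ge_ereal_sup => _ [t /= t0 <-]; rewrite lee_fin.
rewrite (J_scale p1 cu (tent_energy_scales c) t0).
have A0 : 0 < 4 / D by rewrite divr_gt0.
have B0 : 0 < d * (1 - eps) `^ (p + 1).
  by rewrite mulr_gt0// powR_gt0//; lra.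
apply: le_trans (fibre_le p1 A0 B0 t0).
rewrite lerD2l lerN2 ler_pM2l; last by rewrite invr_gt0; lra.
by rewrite ler_pM2l// powR_gt0.
Qed.

End TestFunction.

(** * The equation on an edge *)

Section EdgeODE.
Context {R : realType}.
Notation mu := (@lebesgue_measure R).
Context (l : R) (u g : R -> R).
Context (l0 : 0 < l).
Context (cg : {within `[0, l], continuous g}).
Context (cu : {within `[0, l], continuous u}).
Implicit Types (x y a b : R).

(** The sum of [u'] and a primitive [W] of [g] has derivative [0] in the open
    edge, and a constant minus [W] makes sense on the closed one. *)
Lemma derivative_extension :
  (forall x, 0 < x < l -> derivable u x 1 /\ derivable (derive1 u) x 1) ->
  (forall x, 0 < x < l -> - derive1n 2 u x = g x) ->
  exists v : R -> R, [/\ {within `[0, l], continuous v},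
    forall x, 0 < x < l -> is_derive x 1 u (v x) &
    forall x, 0 < x < l -> is_derive x 1 v (- g x)].
Proof.
move=> du eq.
pose W (x : R) : R := \int[mu]_(t in `[0, x]) g t.
have ig := integrable_seg cg.
have cW : {within `[0, l], continuous W} := parameterized_integral_continuous (ltW l0) ig.
have dW x : 0 < x < l -> is_derive x 1 W (g x).
  move=> /andP[x0 xl].
  have cgx : {for x, continuous g}.
    by apply: (within_continuous_continuous l0 cg); rewrite in_itv/= x0.
  have [d dE] := continuous_FTC1_closed xl ig x0 cgx.
  by apply: DeriveDef; [exact: d|rewrite -derive1E; exact: dE].
have du2 x : 0 < x < l -> is_derive x 1 (derive1 u) (- g x).
  move=> xl; have [_ d2] := du x xl.
  by apply: DeriveDef; [exact: d2|rewrite -derive1E -eq// opprK].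
pose z : R -> R := fun x => derive1 u x + W x.
have dz x : 0 < x < l -> is_derive x 1 z 0.
  move=> xl; have := is_derive1D (du2 x xl) (dW x xl).
  by rewrite addNr.
have zc x y : 0 < x -> x < y -> y < l -> z x = z y.
  move=> x0 xy yl.
  have inside t : x <= t <= y -> 0 < t < l.
    by move=> /andP[xt ty]; rewrite (lt_le_trans x0 xt) (le_lt_trans ty yl).
  have dzxy t : t \in `]x, y[%R -> is_derive t 1 z 0.
    by rewrite in_itv/= => /andP[/ltW xt /ltW ty]; apply: dz; apply: inside; rewrite xt.
  have czxy : {within `[x, y], continuous z}.
    apply: derivable_within_continuous => t; rewrite in_itv/= => txy.
    by have [] := dz t (inside t txy).
  have [c _] := MVT xy dzxy czxy.
  by move/eqP; rewrite mul0r subr_eq0 => /eqP.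
pose h := l / 2.
have h0 : 0 < h by rewrite divr_gt0.
have hl : h < l by rewrite /h ltr_pdivrMr// ltr_pMr// ltr1n.
have zh x : 0 < x < l -> z x = z h.
  move=> /andP[x0 xl]; case: (ltgtP x h) => [xh|hx|->//].
    exact: zc.
  by apply/esym; exact: zc.
pose v x := z h + (- 1) * W x.
have vE x : 0 < x < l -> v x = derive1 u x.
  by move=> xl; rewrite /v -(zh x xl) /z; ring.
exists v; split.
- move=> x; apply: cvgD; first exact: cvg_cst.
  by apply: cvgMr; exact: cW.
- move=> x xl; have [d1 _] := du x xl; rewrite vE//.
  by apply: DeriveDef; [exact: d1|rewrite derive1E].
- move=> x xl; have := is_derive1D (is_derive_cst (z h) x 1) (is_derive1Z (- 1) (dW x xl)).
  by rewrite add0r mulN1r.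
Qed.

Context (v : R -> R).
Context (cv : {within `[0, l], continuous v}).
Context (duv : forall x, 0 < x < l -> is_derive x 1 u (v x)).
Context (dvg : forall x, 0 < x < l -> is_derive x 1 v (- g x)).

Lemma LRcontinuous_seg (f df : R -> R) : {within `[0, l], continuous f} ->
  (forall x, 0 < x < l -> is_derive x 1 f (df x)) ->
  derivable_oo_LRcontinuous f 0 l.
Proof.
move=> /(continuous_within_itvP _ l0)[_ f0 fl] dfx; split => //.
by move=> x; rewrite in_itv/= => /dfx[].
Qed.

Lemma integral_source : \int[mu]_(x in `[0, l]) g x = v 0 - v l.
Proof.
have cNg : {within `[0, l], continuous (fun x => - g x)}.
  by move=> x; apply: cvgN; exact: cg.
have Dv : {in `]0, l[, derive1 v =1 (fun x => - g x)}.
  by move=> x; rewrite in_itv/= derive1E => /dvg ?; exact: derive_val.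
have := continuous_FTC2 l0 cNg (LRcontinuous_seg cv dvg) Dv.
move=> /(congr1 (fun z : \bar R => fine z)) /=.
rewrite -/(Rintegral mu `[0, l] (fun x => - g x)).
have -> : \int[mu]_(x in `[0, l]) (- g x) = - \int[mu]_(x in `[0, l]) g x.
  rewrite -mulN1r -RintegralZl//; last exact: integrable_seg.
  by apply: eq_integral_seg => x _; rewrite mulN1r.
by move=> /eqP; rewrite eqr_oppLR opprB => /eqP.
Qed.

(** Integration by parts of [u * v'] with [v' = - g]. *)
Lemma integral_energy : \int[mu]_(x in `[0, l]) (v x ^+ 2) -
  \int[mu]_(x in `[0, l]) (u x * g x) = u l * v l - u 0 * v 0.
Proof.
have cNg : {within `[0, l], continuous (fun x => - g x)}.
  by move=> x; apply: cvgN; exact: cg.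
have Dv : {in `]0, l[, derive1 v =1 (fun x => - g x)}.
  by move=> x; rewrite in_itv/= derive1E => /dvg ?; exact: derive_val.
have Du : {in `]0, l[, derive1 u =1 v}.
  by move=> x; rewrite in_itv/= derive1E => /duv ?; exact: derive_val.
have := Rintegration_by_parts l0 cv (LRcontinuous_seg cu duv) Du cNg (LRcontinuous_seg cv dvg) Dv.
have -> : \int[mu]_(x in `[0, l]) (u x * - g x) = - \int[mu]_(x in `[0, l]) (u x * g x).
  rewrite -mulN1r -RintegralZl//; last first.
    by apply: integrable_seg; exact: within_continuousM.
  by apply: eq_integral_seg => x _; ring.
have -> : \int[mu]_(x in `[0, l]) (v x ^+ 2) = \int[mu]_(x in `[0, l]) (v x * v x).
  by apply: eq_integral_seg => x _; rewrite expr2.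
lra.
Qed.

Lemma square_integrable_derivative : square_integrable l v.
Proof.
split.
  by apply: subspace_continuous_measurable_fun.
by apply: integrable_seg; exact: (within_continuousM cv cv).
Qed.

Lemma increments_derivative : increments_on l u v.
Proof.
move=> x y x0; rewrite le_eqVlt => /predU1P[<- _|xy yl].
  by rewrite subrr set_itv1 Rintegral_set1.
have sub : `[x, y] `<=` `[0, l].
  move=> t /=; rewrite !in_itv/= => /andP[xt ty].
  by rewrite (le_trans (ltW x0) xt) (le_trans ty (ltW yl)).
have cvs : {within `[x, y], continuous v} := continuous_subspaceW sub cv.
have cus : {within `[x, y], continuous u} := continuous_subspaceW sub cu.
have ins t : x < t < y -> 0 < t < l.
  by move=> /andP[xt ty]; rewrite (lt_trans x0 xt) (lt_trans ty yl).
have Du : {in `]x, y[, derive1 u =1 v}.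
  by move=> t; rewrite in_itv/= derive1E => /ins/duv ?; exact: derive_val.
have LR : derivable_oo_LRcontinuous u x y.
  move: cus => /(continuous_within_itvP _ xy)[_ f0 fl]; split => //.
  by move=> t; rewrite in_itv/= => /ins/duv[].
by rewrite /Rintegral (continuous_FTC2 xy cvs LR Du).
Qed.

Lemma edge_energy_bound a b k : 0 <= a -> a <= b -> b <= l ->
  2 * k * (u b - u a) - k ^+ 2 * (b - a) <=
  \int[mu]_(x in `[0, l]) (`|derive1 u x| ^+ 2).
Proof.
rewrite (integral_derive1_sqr l0 square_integrable_derivative increments_derivative).
apply: energy_bound_closure => // a' b' a0 ab bl.
apply: increment_sqr_bound => //; [exact: square_integrable_derivative|exact: increments_derivative].
Qed.

(** By the mean value theorem the quotient is a value of [v] between [0] and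
    [h]. *)
Lemma right_quotient : (u h - u 0) / h @[h --> 0^'+] --> v 0.
Proof.
have [_ v0 _] := (continuous_within_itvP _ l0).1 cv.
apply/cvgrPdist_le => e e0.
have /cvgrPdist_le/(_ e e0) := v0.
rewrite near_withinE => /nbhs_ballP[r /= r0 rP].
near=> h.
have h0 : 0 < h by near: h; exact: nbhs_right_gt.
have hl : h < l by near: h; exact: nbhs_right_lt.
have hr : h < r by near: h; exact: nbhs_right_lt.
have sub : `[0, h] `<=` `[0, l].
  by move=> t /=; rewrite !in_itv/= => /andP[-> th]; rewrite (le_trans th (ltW hl)).
have dh t : t \in `]0, h[%R -> is_derive t 1 u (v t).
  by rewrite in_itv/= => /andP[t0 th]; apply: duv; rewrite t0 (lt_trans th hl).
have [c] := MVT h0 dh (continuous_subspaceW sub cu).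
rewrite in_itv/= subr0 => /andP[c0 ch] ->.
rewrite mulfK ?gt_eqF//; apply: rP => //.
by rewrite /ball/= sub0r normrN gtr0_norm// (lt_trans ch hr).
Unshelve. all: by end_near. Qed.

Lemma left_quotient : (u (l - h) - u l) / h @[h --> 0^'+] --> - v l.
Proof.
have [_ _ vl] := (continuous_within_itvP _ l0).1 cv.
apply/cvgrPdist_le => e e0.
have /cvgrPdist_le/(_ e e0) := vl.
rewrite near_withinE => /nbhs_ballP[r /= r0 rP].
near=> h.
have h0 : 0 < h by near: h; exact: nbhs_right_gt.
have hl : h < l by near: h; exact: nbhs_right_lt.
have hr : h < r by near: h; exact: nbhs_right_lt.
have sub : `[l - h, l] `<=` `[0, l].
  by move=> t /=; rewrite !in_itv/= => /andP[th ->]; rewrite andbT; apply: le_trans th; lra.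
have lh : l - h < l by lra.
have dh t : t \in `]l - h, l[%R -> is_derive t 1 u (v t).
  by rewrite in_itv/= => /andP[t0 th]; apply: duv; rewrite th andbT; lra.
have [c] := MVT lh dh (continuous_subspaceW sub cu).
rewrite in_itv/= => /andP[c0 ch] cE.
have -> : u (l - h) - u l = - v c * h by rewrite -opprB cE; ring.
rewrite mulfK ?gt_eqF// -opprD normrN; apply: rP => //.
by rewrite /ball/= gtr0_norm; lra.
Unshelve. all: by end_near. Qed.

End EdgeODE.

(** * Solutions under the Kirchhoff and Neumann conditions *)

Section Solutions.
Context {R : realType} (G : graph_data R).
Notation mu := (@lebesgue_measure R).
Context (hG : compact_metric_graph G).
Context (p : R) (u : edge G -> R -> R).
Context (p1 : 1 < p).
Context (hu : lane_emden_solution p u).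
Implicit Types (e : edge G).

Let g e x : R := signed_powR p (u e x).

Let cu e : {within `[0, len e], continuous (u e)}.
Proof. exact: (le_continuous hu).1. Qed.

Let cg e : {within `[0, len e], continuous (g e)}.
Proof.
exact: (edgewise_continuous_comp (continuous_signed_powR p1) (le_continuous hu).1).
Qed.

Lemma solution_derivative : exists v : edge G -> R -> R, forall e,
  [/\ {within `[0, len e], continuous (v e)},
    forall x, 0 < x < len e -> is_derive x 1 (u e) (v e x) &
    forall x, 0 < x < len e -> is_derive x 1 (v e) (- g e x)].
Proof.
have /choice[v Hv] : forall e, exists ve : R -> R,
    [/\ {within `[0, len e], continuous ve},
    forall x, 0 < x < len e -> is_derive x 1 (u e) (ve x) &
    forall x, 0 < x < len e -> is_derive x 1 ve (- g e x)].
  move=> e; exact: (@derivative_extension R (len e) (u e) (g e)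
    (len_gt0 hG e) (@cg e) (le_derivable hu (e := e)) (le_equation hu (e := e))).
by exists v.
Qed.

(** Summing over the vertices first or over the edges first. *)
Lemma sum_endpoints_eq0 (F : edge G -> vertex G -> R) :
  (forall a, \sum_(e | incident e a) F e a = 0) ->
  \sum_e (F e (src e) + F e (tgt e)) = 0.
Proof.
move=> F0; rewrite (eq_bigr (fun e => \sum_(a | incident e a) F e a)).
  by rewrite (exchange_big_dep xpredT)//= big1.
move=> e _; rewrite (bigD1 (src e)) /incident ?eqxx//=; congr (_ + _).
rewrite (bigD1 (tgt e)) /= ?eqxx ?orbT /=; last by rewrite eq_sym (no_loop hG).
rewrite big1 ?addr0// => a /andP[/andP[/orP[]/eqP -> ]]; rewrite ?eqxx//.
Qed.

Context (v : edge G -> R -> R).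
Context (cv : forall e, {within `[0, len e], continuous (v e)}).
Context (duv : forall e x, 0 < x < len e -> is_derive x 1 (u e) (v e x)).
Context (dvg : forall e x, 0 < x < len e -> is_derive x 1 (v e) (- g e x)).

Lemma outward_derivative_src e : outward_derivative u e (src e) = v e 0.
Proof.
rewrite /outward_derivative /outward_quotient eqxx; apply: cvg_lim => //.
exact: (right_quotient (len_gt0 hG e) (@cu e) (@cv e) (@duv e)).
Qed.

Lemma outward_derivative_tgt e : outward_derivative u e (tgt e) = - v e (len e).
Proof.
rewrite /outward_derivative /outward_quotient (negbTE (no_loop hG e)).
apply: cvg_lim => //.
exact: (left_quotient (len_gt0 hG e) (@cu e) (@cv e) (@duv e)).
Qed.

Lemma kirchhoff_neumann a : \sum_(e | incident e a) outward_derivative u e a = 0.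
Proof.
have /orP[h|h] := vertex_int_or_end hG a; first exact: (le_kirchhoff hu).
by rewrite big1// => e ea; exact: (le_neumann hu).
Qed.

(** The integral over an edge is the sum of the outward derivatives at its
    ends, and these cancel at every vertex. *)
Lemma gint_signed_powR_eq0 : gint (fun e x => signed_powR p (u e x)) = 0.
Proof.
rewrite -(sum_endpoints_eq0 kirchhoff_neumann); apply: eq_bigr => e _.
rewrite (integral_source (len_gt0 hG e) (@cg e) (@cv e) (@dvg e)).
by rewrite outward_derivative_src outward_derivative_tgt.
Qed.

(** The boundary terms are the outward derivatives times the value of [u] at the
    vertex, a common factor of the edges meeting there. *)
Lemma gint_derivative_sqr : gint (fun e x => v e x ^+ 2) =
  gint (fun e x => `|u e x| `^ (p + 1)).
Proof.
apply/eqP; rewrite -subr_eq0 /gint -sumrB.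
pose F e a := - (u e (end_coord e a) * outward_derivative u e a).
have F0 a : \sum_(e | incident e a) F e a = 0.
  have [e0 he0] := exists_incident hG a.
  rewrite (eq_bigr (fun e => - u e0 (end_coord e0 a) * outward_derivative u e a)).
    by rewrite -mulr_sumr kirchhoff_neumann mulr0.
  move=> e ea; rewrite /F -mulNr; congr (- _ * _).
  exact: (le_continuous hu).2 (at_end_coord ea) (at_end_coord he0).
apply/eqP; apply: etrans (sum_endpoints_eq0 F0); apply: eq_bigr => e _.
rewrite /F /end_coord eqxx (negbTE (no_loop hG e)).
rewrite outward_derivative_src outward_derivative_tgt.
rewrite (_ : \int[mu]_(x in `[0, len e]) (`|u e x| `^ (p + 1)) =
             \int[mu]_(x in `[0, len e]) (u e x * g e x)).
  rewrite (integral_energy (len_gt0 hG e) (@cg e) (@cu e) (@cv e) (@duv e) (@dvg e)).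
  by rewrite mulrN opprK addrC.
by apply: eq_integral_seg => x _; rewrite /g mul_signed_powR.
Qed.

End Solutions.

Lemma solution_energy (R : realType) (G : graph_data R) (p : R)
    (u : edge G -> R -> R) :
  compact_metric_graph G -> 1 < p -> lane_emden_solution p u ->
  [/\ gint (fun e x => signed_powR p (u e x)) = 0,
     gint (fun e x => `|derive1 (u e) x| ^+ 2) = gint (fun e x => `|u e x| `^ (p + 1)) &
     forall e a b k, 0 <= a -> a <= b -> b <= len e ->
       2 * k * (u e b - u e a) - k ^+ 2 * (b - a) <=
       \int[lebesgue_measure]_(x in `[0, len e]) (`|derive1 (u e) x| ^+ 2)].
Proof.
move=> hG p1 hu; have cu := (le_continuous hu).1.
have [v Hv] := solution_derivative hG p1 hu.
have cv e : {within `[0, len e], continuous (v e)} by have [] := Hv e.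
have duv e x : 0 < x < len e -> is_derive x 1 (u e) (v e x).
  by have [_ h _] := Hv e; exact: h.
have dvg e x : 0 < x < len e -> is_derive x 1 (v e) (- signed_powR p (u e x)).
  by have [_ _ h] := Hv e; exact: h.
split.
- exact: (gint_signed_powR_eq0 hG p1 hu cv duv dvg).
- rewrite -(gint_derivative_sqr hG p1 hu cv duv dvg) /gint; apply: eq_bigr => e _.
  apply: integral_derive1_sqr (len_gt0 hG e) _ _.
    exact: square_integrable_derivative.
  exact: (increments_derivative (@cu e) (@cv e) (@duv e)).
- move=> e a b k.
  exact: (edge_energy_bound (len_gt0 hG e) (@cu e) (@cv e) (@duv e)).
Qed.

(** * Least energy solutions for large exponents *)

Section LeastEnergy.
Context {R : realType} (G : graph_data R).
Notation mu := (@lebesgue_measure R).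
Context (hG : compact_metric_graph G).
Context (acyc : without_cycles G).
Context (v w : vertex G).
Let D := vdist v w.
Context (D0 : 0 < D).
Context (hD : forall (e : edge G) x e' x', 0 <= x <= len e -> 0 <= x' <= len e' ->
  tree_dist e x e' x' <= D).
Implicit Types (e : edge G) (u : edge G -> R -> R) (p : R).

(** As the signed mean vanishes, [|u| ^ (p + 1)], which is [u] times its signed
    power, may be replaced by [u - m] times it; that product is nonpositive
    where [u] is. *)
Lemma gint_powR_le p u (m M : R) : 1 < p -> edgewise_continuous u ->
  m <= 0 -> 0 <= M ->
  (forall e x, 0 <= x <= len e -> m <= u e x <= M) ->
  gint (fun e x => signed_powR p (u e x)) = 0 ->
  gint (fun e x => `|u e x| `^ (p + 1)) <= (M - m) * M `^ p * total_length G.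
Proof.
move=> p1 cu m0 M0 umM u0.
have cq := edgewise_continuous_comp (continuous_signed_powR p1) cu.
have cB : edgewise_continuous (fun e x => `|u e x| `^ (p + 1)).
  apply: (edgewise_continuous_comp (continuous_abs_powR (_ : 0 < p + 1)) cu); lra.
have iq := edgewise_continuous_integrable cq.
have iB := edgewise_continuous_integrable cB.
have imq : edgewise_integrable (fun e x => m * signed_powR p (u e x)).
  by move=> e; exact: integrable_segZ.
rewrite -[leLHS]subr0 -(mulr0 m) -u0 -gintZ// -gintB// -(gint_cst (len_gt0 hG)).
apply: gint_le => [e|e|e x xe].
- exact: integrable_segB.
- exact: integrable_cst_seg.
rewrite -mul_signed_powR// -mulrBl -ge0_signed_powR//.
have /andP[mu_ uM] := umM e x xe.
have [u_ge0|/ltW u_le0] := leP 0 (u e x).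
  apply: ler_pM; rewrite ?subr_ge0//.
  - exact: signed_powR_ge0.
  - by rewrite lerB.
  - exact: ler_signed_powR.
apply: (@le_trans _ _ 0).
  rewrite mulr_ge0_le0 ?subr_ge0// -oppr_ge0 -signed_powRN signed_powR_ge0//.
  by rewrite oppr_ge0.
by rewrite mulr_ge0 ?signed_powR_ge0// subr_ge0 (le_trans m0).
Qed.

(** For a solution [J p u] is a positive multiple of the Dirichlet energy, so
    [sigma_gt0] excludes the trivial solution. *)
Lemma least_energy_gt0 p u : 1 < p -> least_energy_solution p u ->
  [/\ gint (fun e x => `|derive1 (u e) x| ^+ 2) = gint (fun e x => `|u e x| `^ (p + 1)),
   0 < gint (fun e x => `|derive1 (u e) x| ^+ 2) &
   sigma G p = ((2^-1 - (p + 1)^-1) * gint (fun e x => `|derive1 (u e) x| ^+ 2))%:E].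
Proof.
move=> p1 [su Ju]; have [_ aE _] := solution_energy hG p1 su.
have JE : J p u = (2^-1 - (p + 1)^-1) * gint (fun e x => `|derive1 (u e) x| ^+ 2).
  by rewrite /J -aE mulrBl.
have c0 : 0 < 2^-1 - (p + 1)^-1.
  by rewrite subr_gt0 ltf_pV2 ?posrE; lra.
split => //; last by rewrite -Ju JE.
have [e0 _] := exists_incident hG v.
have := sigma_gt0 hG acyc e0 D0 hD p1.
by rewrite -Ju JE lte_fin pmulr_rgt0.
Qed.

(** [s] is the smaller of the two extremal amplitudes [M] and [- m].  The
    inequalities [(M - m) ^ 2 <= a D] and [a <= (M - m) s ^ p |G|] give
    [2 s <= M - m <= D |G| s ^ p], which keeps [s] away from [0]. *)
Lemma amplitude_lower_bound p u (xmax xmin : gpoint G) : 1 < p ->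
  least_energy_solution p u -> maximum_point u xmax -> minimum_point u xmin ->
  exists2 s, 0 < s /\ 2 / (D * total_length G) <= s `^ (p - 1) &
    4 * s ^+ 2 <= gint (fun e x => `|derive1 (u e) x| ^+ 2) * dist xmin xmax.
Proof.
move=> p1 lu hmax hmin; have [aE a0 _] := least_energy_gt0 p1 lu.
have [su _] := lu; have [q0 _ Eb] := solution_energy hG p1 su.
have [cu uV] := le_continuous su.
have [e0 _] := exists_incident hG v.
have L0 := total_length_gt0 hG e0.
set a := gint _ in aE a0 *.
set M := u (pedge xmax) (pcoord xmax); set m := u (pedge xmin) (pcoord xmin).
have umM e x (xe : 0 <= x <= len e) : m <= u e x <= M.
  by rewrite (hmin (GPoint xe)) (hmax (GPoint xe)).
have M0 : 0 <= M.
  have [e [x [xe ux]]] := exists_ge0 (len_gt0 hG) e0 p1 cu q0.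
  by apply: le_trans ux _; have /andP[] := umM e x xe.
have m0 : m <= 0.
  have [e [x [xe ux]]] := exists_le0 (len_gt0 hG) e0 p1 cu q0.
  by apply: le_trans ux; have /andP[] := umM e x xe.
have delta : (M - m) ^+ 2 <= a * dist xmin xmax.
  rewrite -sqrrN opprB dist_tree_dist// /a /gint mulr_suml.
  exact: (increment_energy_bound hG acyc uV Eb (pcoordP xmin) (pcoordP xmax)).
have aM : a <= (M - m) * M `^ p * total_length G.
  by rewrite aE; apply: gint_powR_le.
have am : a <= (M - m) * (- m) `^ p * total_length G.
  (* The same bound for [- u], whose extrema are [- m] and [- M]. *)
  rewrite aE (_ : M - m = - m - - M); last by rewrite opprK addrC.
  rewrite (@eq_gint _ _ _ (fun e x => `|- u e x| `^ (p + 1))); last first.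
    by move=> e x _; rewrite normrN.
  apply: gint_powR_le => //; rewrite ?oppr_le0 ?oppr_ge0//.
  - by apply: edgewise_continuous_comp cu; exact: opp_continuous.
  - by move=> e x /umM; rewrite !lerN2 andbC.
  - rewrite (@eq_gint _ _ _ (fun e x => - 1 * signed_powR p (u e x))).
      rewrite gintZ ?q0 ?mulr0//; apply: edgewise_continuous_integrable.
      by apply: edgewise_continuous_comp cu; exact: continuous_signed_powR.
    by move=> e x _; rewrite signed_powRN mulN1r.
pose s := Num.min M (- m).
have s0 : 0 <= s by rewrite le_min M0 oppr_ge0.
have as_ : a <= (M - m) * s `^ p * total_length G by rewrite /s; case: (leP M (- m)).
have Mm_ge : 2 * s <= M - m.
  have : s <= M by rewrite ge_min lexx.
  have : s <= - m by rewrite ge_min lexx orbT.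
  lra.
have Mm0 : 0 < M - m.
  rewrite lt_neqAle subr_ge0 (le_trans m0 M0) andbT eq_sym; apply/eqP => Mm.
  by move: aM; rewrite Mm !mul0r leNgt a0.
have dD : dist xmin xmax <= D.
  by rewrite dist_tree_dist//; apply: hD; exact: pcoordP.
have key : M - m <= D * total_length G * s `^ p.
  rewrite -(ler_pM2l Mm0) -expr2; apply: le_trans delta _.
  apply: (@le_trans _ _ (a * D)); first by rewrite ler_pM2l.
  rewrite [leRHS](_ : _ = (M - m) * s `^ p * total_length G * D); last by ring.
  by rewrite ler_pM2r.
have s_gt0 : 0 < s.
  rewrite lt_neqAle s0 andbT; apply/eqP => s00.
  by move: key; rewrite -s00 powR0 ?mulr0 ?leNgt ?Mm0// gt_eqF//; lra.
exists s; last first.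
  apply: le_trans delta.
  have -> : 4 * s ^+ 2 = (2 * s) ^+ 2 by ring.
  by rewrite ler_pXn2r ?nnegrE ?mulr_ge0// ltW.
split => //; rewrite ler_pdivrMr ?mulr_gt0// -(ler_pM2r s_gt0).
apply: le_trans Mm_ge _; apply: le_trans key _.
rewrite [leRHS](_ : _ = D * total_length G * (s * s `^ (p - 1))); last by ring.
by rewrite mulr_powRB1//; lra.
Qed.

(** Put [b = 1 - eps].  Comparing the bounds for the energy gives
    [K b ^ (p + 1) <= (dist / D) ^ ((p - 1) / 2)] for a constant [K > 0].  If
    [dist < b ^ 3 D] then [K <= b ^ ((p - 5) / 2)], which fails for large
    [p]; any power of [b] above [2] would do in place of [3]. *)
Lemma dist_lower_bound eps : 0 < eps < 1 -> exists P : R,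
  forall p u (xmax xmin : gpoint G), 1 < p -> P < p ->
  least_energy_solution p u -> maximum_point u xmax -> minimum_point u xmin ->
  (1 - eps) ^+ 3 * D <= dist xmin xmax.
Proof.
move=> eps01; have /andP[eps0 eps1] := eps01.
have [d d0 sub] := sigma_upper_bound hG acyc D0 eps01.
have [e0 _] := exists_incident hG v.
have L0 := total_length_gt0 hG e0.
pose b := 1 - eps; have b0 : 0 < b by rewrite /b; lra.
have b1 : b < 1 by rewrite /b; lra.
have lnb : ln b < 0 by rewrite ln_lt0// b0.
pose K := 2 / (D * total_length G) * d * (D / 4).
have K0 : 0 < K by rewrite !mulr_gt0// ?invr_gt0 ?mulr_gt0.
(* Beyond this value of [p], [b ^ ((p - 5) / 2)] is smaller than [K]. *)
exists (5 + 2 * (ln K / ln b)) => p u xmax xmin p1 Pp lu hmax hmin.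
have [aE a0 sE] := least_energy_gt0 p1 lu.
have [s [s0 sk] sd] := amplitude_lower_bound p1 lu hmax hmin.
have := sub p p1; rewrite sE lee_fin ler_pM2l; last first.
  by rewrite subr_gt0 ltf_pV2 ?posrE; lra.
set a := gint _ in a0 sd *; rewrite -/b -/D.
set X := 4 / D / _; move=> aX.
have X0 : 0 < X by rewrite !divr_gt0// mulr_gt0// powR_gt0.
set delta := dist xmin xmax in sd *.
rewrite leNgt; apply/negP => small.
pose r := (p - 1) / 2; have r0 : 0 < r by rewrite /r; lra.
have delta0 : 0 < delta.
  rewrite -(pmulr_rgt0 _ a0); apply: lt_le_trans sd.
  by rewrite mulr_gt0// exprn_gt0.
have s2 : s ^+ 2 <= delta / D * X `^ (2 / (p - 1)).
  have h : 4 * s ^+ 2 <= 4 / D * X `^ (2 / (p - 1)) * delta.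
    by apply: le_trans sd _; rewrite ler_pM2r.
  rewrite -(ler_pM2l (_ : 0 < 4 :> R))//; apply: le_trans h _.
  by rewrite le_eqVlt; apply/orP; left; apply/eqP; field; rewrite gt_eqF.
have dD0 : 0 <= delta / D by rewrite divr_ge0// ltW.
have sr : s `^ (p - 1) <= (delta / D) `^ r * X.
  have -> : s `^ (p - 1) = (s ^+ 2) `^ r.
    rewrite -powR_mulrn ?ltW// -powRrM; congr (_ `^ _).
    by rewrite /r; field.
  have -> : (delta / D) `^ r * X = (delta / D * X `^ (2 / (p - 1))) `^ r.
    rewrite [RHS]powRM ?powR_ge0// -powRrM.
    rewrite (_ : 2 / (p - 1) * r = 1) ?powRr1 ?ltW//.
    by rewrite /r; field; rewrite subr_eq0 gt_eqF.
  apply: ge0_ler_powR; rewrite ?nnegrE ?sqr_ge0 ?(ltW r0)//.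
  exact: mulr_ge0 dD0 (powR_ge0 _ _).
have br : (delta / D) `^ r <= b `^ (3 * r).
  rewrite powRrM (_ : b `^ 3 = b ^+ 3); last by rewrite -powR_mulrn// ltW.
  apply: ge0_ler_powR; rewrite ?nnegrE ?dD0 ?exprn_ge0 ?(ltW r0) ?(ltW b0)//.
  by rewrite ler_pdivrMr// ltW.
have bK : K <= b `^ ((p - 5) / 2).
  have h : 2 / (D * total_length G) <= b `^ (3 * r) * X.
    by apply: le_trans sk _; apply: le_trans sr _; rewrite ler_pM2r.
  have -> : (p - 5) / 2 = 3 * r - (p + 1) by rewrite /r; field.
  rewrite powRD; last by rewrite (gt_eqF b0) implybT.
  rewrite powRN.
  have bp : 0 < b `^ (p + 1) by exact: powR_gt0.
  have -> : b `^ (3 * r) / b `^ (p + 1) = b `^ (3 * r) * X * d * (D / 4).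
    by rewrite /X; field; rewrite !gt_eqF.
  by rewrite /K ler_pM2r ?divr_gt0// ler_pM2r.
have : ln K <= (p - 5) / 2 * ln b.
  by rewrite -ln_powR ler_ln ?posrE// powR_gt0.
have h : ln K / ln b < (p - 5) / 2 by lra.
by rewrite leNgt -ltr_ndivrMr// h.
Qed.

End LeastEnergy.

Theorem theorem4 (R : realType) (G : graph_data R)
    (hG : compact_metric_graph G) (hacyclic : without_cycles G)
    (u : R -> edge G -> R -> R) (xmax xmin : R -> gpoint G)
    (hu : forall p : R, 1 < p -> least_energy_solution p (u p))
    (hmax : forall p : R, 1 < p -> maximum_point (u p) (xmax p))
    (hmin : forall p : R, 1 < p -> minimum_point (u p) (xmin p)) :
  exists2 d : R, is_max_dist G d
    & dist (xmin p) (xmax p) @[p --> +oo] --> d.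
Proof.
have [v [w [D0 hD maxD]]] := exists_diameter hG hacyclic.
exists (vdist v w) => //; apply/cvgrPdist_le => e e0.
set D := vdist v w in D0 hD maxD *.
(* [3 * eps * D <= e] absorbs the loss [1 - (1 - eps) ^ 3 <= 3 * eps]. *)
pose eps := Num.min 2^-1 (e / (3 * D)).
have D30 : 0 < 3 * D by rewrite mulr_gt0.
have eps0 : 0 < eps by rewrite lt_min invr_gt0 ltr0n divr_gt0.
have epsh : eps <= 2^-1 by rewrite ge_min lexx.
have epse : eps * (3 * D) <= e.
  by rewrite -ler_pdivlMr// ge_min lexx orbT.
have eps01 : 0 < eps < 1 by rewrite eps0/=; lra.
have [P HP] := dist_lower_bound hG hacyclic D0 hD eps01.
near=> p.
have p1 : 1 < p by near: p; apply: nbhs_pinfty_gt; exact: num_real.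
have Pp : P < p by near: p; apply: nbhs_pinfty_gt; exact: num_real.
have low := HP p _ _ _ p1 Pp (hu p p1) (hmax p p1) (hmin p p1).
have up := maxD.2 (xmin p) (xmax p).
rewrite ger0_norm ?subr_ge0// lerBlDr -lerBlDl; apply: le_trans low.
have : 1 - 3 * eps <= (1 - eps) ^+ 3.
  have -> : (1 - eps) ^+ 3 = 1 - 3 * eps + eps ^+ 2 * (3 - eps) by ring.
  by rewrite lerDl mulr_ge0 ?sqr_ge0//; lra.
rewrite -(ler_pM2r D0); apply: le_trans; lra.
Unshelve. all: by end_near. Qed.
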